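(* Let $\mathbf u\in\mathbb Z^n_{>0}$, $Q\in S$ a nonzero $\mathbf u$-homogeneous polynomial, and $\mathbf v\in\mathbb Z^n$ with $\mathbf u+\mathbf v=(k,\dots,k)$ for some $k\in\mathbb Z$. Then $\chi\big(D^{(\mathbf u,\mathbf v)}(Q)\big)=\deg^{\mathbf u}(Q)+|\mathbf v|$.
   Context: $\mathbb K$ a field of characteristic zero, $S=\mathbb K[x_1,\dots,x_n]$, $D=\mathrm{Der}_{\mathbb K}(S)$ with basis $\partial_i=\partial/\partial x_i$. For $g\in S$, $e\ge1$: $D(g;e)=\{\delta\in D:\delta(g)\in g^eS\}$; for nonzero $f=cf_1^{e_1}\cdots f_r^{e_r}$ (pairwise non-associate irreducibles), $D(f)=\bigcap_iD(f_i;e_i)$. $S^{\mathbf u}$: $S$ graded by $\deg x_i=u_i$, $\deg^{\mathbf u}$ the weighted degree. $D^{(\mathbf u,\mathbf v)}$: $D$ graded by $\deg(a\partial_i)=\deg^{\mathbf u}(a)+v_i$; $D^{(\mathbf u,\mathbf v)}(Q)$ is $D(Q)$ with the induced grading. $|\mathbf v|=\sum v_i$. For a finitely generated graded $S^{\mathbf u}$-module $M$, $HP_M(t)=\sum_j\dim_{\mathbb K}M_jt^j$ and $\chi(M)=\big[\prod_i(1-t^{u_i})HP_M(t)\big]'(1)$. *)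

(* Defs.v *)
From HB Require Import structures.
From mathcomp Require Import all_boot all_order all_algebra.
From mathcomp Require Import mpoly.
Set Implicit Arguments. Unset Strict Implicit. Unset Printing Implicit Defensive.
Import Order.TTheory GRing.Theory Num.Theory.
Local Open Scope ring_scope.

Section Defs.
Variables (K : fieldType) (n : nat).
Local Notation S := {mpoly K[n]}.

(* D = Der_K(S) is the free S-module with basis d_1..d_n; an element
   delta = sum_i a_i d_i is represented by its coefficient function. *)
Definition Der := 'I_n -> S.

Definition der_apply (d : Der) (g : S) : S := \sum_(i < n) d i * g^`M(i).

Definition mdvd (a b : S) : Prop := exists c : S, b = c * a.

Definition Dge (g : S) (e : nat) (d : Der) : Prop := mdvd (g ^+ e) (der_apply d g).

Definition mirreducible (p : S) : Prop :=
  [/\ p != 0, p \isn't a GRing.unit &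
      forall a b : S, p = a * b -> a \is a GRing.unit \/ b \is a GRing.unit].

Definition massociated (p q : S) : Prop :=
  exists w : S, w \is a GRing.unit /\ p = w * q.

Definition Dlog (f : S) (d : Der) : Prop :=
  forall (r : nat) (c : K) (fs : 'I_r -> S) (es : 'I_r -> nat),
    c != 0 ->
    (forall i, mirreducible (fs i)) ->
    (forall i, (0 < es i)%N) ->
    (forall i j, i != j -> ~ massociated (fs i) (fs j)) ->
    f = c%:MP * \prod_(i < r) fs i ^+ es i ->
    forall i, Dge (fs i) (es i) d.

Definition wdeg (u : 'I_n -> int) (m : 'X_{1..n}) : int :=
  \sum_(i < n) u i * (m i)%:Z.

(* p is u-homogeneous of weighted degree j (0 is homogeneous of every degree) *)
Definition whomog (u : 'I_n -> int) (j : int) (p : S) : Prop :=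
  forall m, m \in msupp p -> wdeg u m = j.

(* degree-j component of D^{(u,v)}(Q): deg(a d_i) = deg^u(a) + v_i *)
Definition Dpiece (u v : 'I_n -> int) (Q : S) (j : int) (d : Der) : Prop :=
  Dlog Q d /\ forall i, whomog u (j - v i) (d i).

Definition has_dim (P : Der -> Prop) (dim : nat) : Prop :=
  exists b : 'I_dim -> Der,
    [/\ forall k, P (b k),
        forall c : 'I_dim -> K,
          (forall i, \sum_(k < dim) c k *: b k i = 0) -> forall k, c k = 0 &
        forall x, P x -> exists c : 'I_dim -> K,
          forall i, x i = \sum_(k < dim) c k *: b k i].

(* coefficient of t^j in prod_i (1 - t^{u_i}) * sum_j h_j t^j *)
Definition hcoef (u : 'I_n -> int) (h : int -> nat) (j : int) : int :=
  \sum_(A : {set 'I_n}) (-1) ^+ #|A| * (h (j - \sum_(i in A) u i))%:Z.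

(* chi = [prod_i (1 - t^{u_i}) HP(t)]'(1): the product is a Laurent
   polynomial (finitely supported), and its derivative at 1 is sum_j j c_j *)
Definition chi_is (u : 'I_n -> int) (h : int -> nat) (x : int) : Prop :=
  exists N : nat,
    (forall j : int, N%:Z < `|j| -> hcoef u h j = 0) /\
    \sum_(0 <= k < (N.*2).+1) (k%:Z - N%:Z) * hcoef u h (k%:Z - N%:Z) = x.

End Defs.

(* Main.v *)
Require Import Defs.
From HB Require Import structures.
From mathcomp Require Import all_boot all_order all_algebra.
From mathcomp Require Import mpoly.
From mathcomp Require Import boolp zify ring.
Import Order.TTheory GRing.Theory Num.Theory.
Local Open Scope ring_scope.

(** Write K_M(t) = prod_i (1 - t^{u_i}) HP_M(t).  The Hilbert function of a
    graded submodule of a free module counts leading monomials, which form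
    up-sets of N^n; hence K_M is a Laurent polynomial.  As HP_M has nonnegative
    coefficients, K_M(1) >= 0, and K_M(1) = 0 forces K_M'(1) <= 0.

    Let Q = c prod_i f_i^{e_i} and g_i = prod_{j <> i} f_j^{e_j}.
    Evaluation delta |-> (delta(f_i))_i embeds D / D(Q) in the sum of the
    S / f_i^{e_i}, up to shifts (this is where u + v = (k, ..., k) is needed).
    Conversely, choose partial derivatives theta_i with theta_i(f_i) not
    divisible by f_i; then (a_i)_i |-> sum_i a_i g_i theta_i embeds the same sum,
    with other shifts, in D / D(Q).  Both bounds have K(1) = 0 and
    K'(1) = - sum_i e_i deg f_i = - deg Q, and these values do not see the shifts, so
    positivity of the two differences pins down K'(1) for D / D(Q). *)

Set Implicit Arguments. Unset Strict Implicit. Unset Printing Implicit Defensive.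

(** * Dimensions of subspaces given by predicates *)

(** [D(Q)] need not be free, so no basis or resolution gives its K directly; K is only squeezed.
    Both comparison modules have K of the form sum_i t^{s_i} (1 - t^{e_i deg f_i}) and differ only
    in the s_i. A factor t^s does not change the derivative at 1 of a function vanishing at 1, so
    both sides of the squeeze give the same number. The value at 1 has to be settled before the
    derivative: the two differences take opposite values at 1, both nonnegative, hence both zero,
    and only then does positivity bound the derivatives, which are again opposite. Evaluation at f_i
    is homogeneous because a_m d_m(f_i) has degree (j - v_m) + (deg f_i - u_m) = j + deg f_i - k,
    the same for every m. The degrees of the f_i make sense because factors of a homogeneous
    polynomial are homogeneous. The second map is injective by a diagonal argument: g_j contains
    f_i^{e_i} for j <> i, so applying sum_j a_j g_j theta_j to f_i leaves, modulo f_i^{e_i}, only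
    a_i g_i theta_i(f_i), and g_i theta_i(f_i) is prime to f_i. Characteristic zero enters through
    the existence of theta_i. *)

Section Dim.
Variables (K : fieldType).

Section OneSpace.
Variable V : lmodType K.

Definition comb d (b : 'I_d -> V) (c : 'I_d -> K) : V := \sum_(k < d) c k *: b k.

Definition linfree d (b : 'I_d -> V) :=
  forall c, comb b c = 0 -> forall k, c k = 0.

Definition hasdim (P : V -> Prop) (d : nat) := exists b : 'I_d -> V,
  [/\ forall k, P (b k), linfree b & forall x, P x -> exists c, x = comb b c].

Definition subspace (P : V -> Prop) :=
  P 0 /\ forall a x y, P x -> P y -> P (a *: x + y).

Definition famcat p q (b : 'I_p -> V) (y : 'I_q -> V) (k : 'I_(p + q)) : V :=
  match split k with inl i => b i | inr j => y j end.

Lemma comb_famcat p q (b : 'I_p -> V) (y : 'I_q -> V) c :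
  comb (famcat b y) c =
  comb b (fun i => c (lshift q i)) + comb y (fun j => c (rshift p j)).
Proof.
rewrite /comb big_split_ord /famcat; congr (_ + _); apply: eq_bigr => i _.
  by rewrite (unsplitK (inl i)).
by rewrite (unsplitK (inr i)).
Qed.

(** If [q < p], the coefficient matrix has rank below [p], and a nonzero row vector killing it is a
    nontrivial relation among the [b k]. *)
Lemma linfree_le p q (b : 'I_p -> V) (b' : 'I_q -> V) :
  linfree b -> (forall k, exists c, b k = comb b' c) -> (p <= q)%N.
Proof.
move=> fb /choice[A hA]; rewrite leqNgt; apply/negP => lt_qp.
pose M := \matrix_(i < p, j < q) A i j.
have : kermx M != 0.
  rewrite kermx_eq0 /row_free neq_ltn; apply/orP; left.
  by apply: leq_ltn_trans lt_qp; exact: rank_leq_col.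
case/rowV0Pn => c /sub_kermxP cM0 /rV0Pn[k]; apply/negP; rewrite negbK; apply/eqP.
apply: (fb (fun i => c 0 i)) k; rewrite /comb.
under eq_bigr => i _ do rewrite hA /comb scaler_sumr.
rewrite exchange_big /= big1 // => j _.
under eq_bigr => i _ do rewrite scalerA.
rewrite -scaler_suml.
have -> : \sum_(i < p) c 0 i * A i j = 0; last by rewrite scale0r.
move/matrixP/(_ 0 j): cM0; rewrite !mxE => e; rewrite -[RHS]e.
by apply: eq_bigr => i _; rewrite mxE.
Qed.

Lemma subspace_comb P d (b : 'I_d -> V) c :
  subspace P -> (forall k, P (b k)) -> P (comb b c).
Proof.
case=> P0 PD Pb; rewrite /comb; elim/big_rec: _ => // i x _ Px.
exact: PD.
Qed.

Lemma hasdim_ext P P' d :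
  (forall x, P x <-> P' x) -> hasdim P d -> hasdim P' d.
Proof.
move=> PP' [b [Pb fb sb]]; exists b; split=> // [k|x /PP'/sb //].
exact/PP'.
Qed.

End OneSpace.

Lemma hasdim_image (V W : lmodType K) (f : V -> W) (P : V -> Prop)
    (P' : W -> Prop) d :
  (forall a x y, f (a *: x + y) = a *: f x + f y) ->
  (forall x, f x = 0 -> x = 0) ->
  (forall x, P x -> P' (f x)) ->
  (forall y, P' y -> exists2 x, P x & y = f x) ->
  hasdim P d -> hasdim P' d.
Proof.
move=> flin finj fP fsurj [b [Pb fb sb]].
have f0 : f 0 = 0.
  by have := flin (-1) 0 0; rewrite scaler0 add0r scaleN1r addNr.
have fcomb c : f (comb b c) = comb (fun k => f (b k)) c.
  rewrite /comb; elim/big_rec2: _ => // i x y _ <-; exact: flin.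
exists (fun k => f (b k)); split=> [k|c|y /fsurj[x /sb[c ->] ->]].
- exact/fP.
- by rewrite -fcomb => /finj; exact: fb.
- by exists c.
Qed.

(* A family of [P] free modulo the preimage of [T] maps to a family of [R]
   free modulo [T]; take a maximal one. *)
Lemma codim_le (V W : lmodType K) (f : V -> W) (P P' : V -> Prop)
    (R T : W -> Prop) p p' r t :
  (forall a x y, f (a *: x + y) = a *: f x + f y) ->
  subspace P -> (forall x, P' x <-> P x /\ T (f x)) ->
  subspace R -> (forall y, T y -> R y) -> (forall x, P x -> R (f x)) ->
  hasdim P p -> hasdim P' p' -> hasdim R r -> hasdim T t -> subspace T ->
  (p + t <= r + p')%N.
Proof.
move=> flin sP PP' sR TR PR [bP [bPP fP spP]] [b' [b'P fb' sb']] [bR [bRR fR sR']]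
  [bT [bTT fT sT]] subT.
have f0 : f 0 = 0.
  by have := flin (-1) 0 0; rewrite scaler0 add0r scaleN1r addNr.
have fcomb d (b : 'I_d -> V) c : f (comb b c) = comb (fun k => f (b k)) c.
  rewrite /comb; elim/big_rec2: _ => // i x y _ <-; exact: flin.
pose relfree m := exists2 y : 'I_m -> V, (forall k, P (y k)) &
  forall c, T (f (comb y c)) -> forall k, c k = 0.
have bound m : relfree m -> (m + t <= r)%N.
  case=> y Py fy.
  apply: (linfree_le (b := famcat (fun k => f (y k)) bT) (b' := bR)) => [c|k].
    rewrite comb_famcat -fcomb => e.
    have c1 : forall i, c (lshift t i) = 0.
      apply: fy; move/eqP: e; rewrite addr_eq0 => /eqP ->.
      rewrite -scaleN1r -[_ *: _]addr0; apply: (proj2 subT); last exact: (proj1 subT).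
      exact: subspace_comb.
    have c2 : forall i, c (rshift m i) = 0.
      apply: fT; move: e; rewrite [X in f X]big1 ?f0 ?add0r // => i _.
      by rewrite c1 scale0r.
    by move=> k; rewrite -(splitK k); case: (split k) => i; [exact: c1|exact: c2].
  by apply: sR'; rewrite /famcat; case: (split k) => i; [apply/PR/Py|apply/TR/bTT].
have [m [[y Py fy] maxm]] : exists m, relfree m /\ ~ relfree m.+1.
  apply: contrapT => nex.
  have all m : relfree m.
    elim: m => [|m IH]; first by exists (fun=> 0) => [|c _] [].
    by apply: contrapT => nm; apply: nex; exists m.
  by have := bound _ (all r.+1); rewrite leqNgt ltnS leq_addr.
have mt : (m + t <= r)%N by apply: bound; exists y.
(* By maximality, adjoining [bP k] to [y] gives a nontrivial combination lying in [P']. Its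
   coefficient at [bP k] is nonzero, as the [y] alone are free modulo [T]; solving for [bP k] puts
   it in the span of [b'] and [y]. *)
suff : (p <= p' + m)%N.
  move=> le1; rewrite (leq_trans (leq_add le1 (leqnn t))) // -addnA addnC.
  by rewrite leq_add2r.
apply: (linfree_le (b := bP) (b' := famcat b' y)) fP _ => k.
pose z (i : 'I_m.+1) := if unlift ord_max i is Some j then y j else bP k.
have : ~ (forall c, T (f (comb z c)) -> forall k, c k = 0).
  move=> fz; apply: maxm; exists z => // i; rewrite /z.
  by case: unlift => [j|]; [exact: Py|exact: bPP].
move=> nfz.
have [c Tc [i ci]] : exists2 c, T (f (comb z c)) & exists i, c i <> 0.
  apply: contrapT => nex; apply: nfz => c Tc i; apply: contrapT => ci.
  by apply: nex; exists c => //; exists i.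
have combz : comb z c = comb y (fun j => c (lift ord_max j)) + c ord_max *: bP k.
  rewrite /comb (bigD1 ord_max) //= addrC /z unlift_none; congr (_ + _).
  rewrite (reindex_omap (lift ord_max) (unlift ord_max)) /=; last first.
    by move=> j; case: unliftP => //= [j' ->|->]; rewrite ?eqxx.
  apply: eq_big => [j|j _]; last by rewrite liftK.
  by rewrite liftK eqxx andbT eq_sym neq_lift.
have cmax : c ord_max != 0.
  apply/eqP => c0; move: Tc; rewrite combz c0 scale0r addr0 => /fy cy.
  by case: (unliftP ord_max i) ci => [j ->|->].
have : P' (comb z c).
  apply/PP'; split=> //; apply: subspace_comb => // i'; rewrite /z.
  by case: unlift => [j|]; [exact: Py|exact: bPP].
case/sb' => c' ec'.
exists (fun l => (c ord_max)^-1 * match split l with inl i => c' i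
  | inr j => - c (lift ord_max j) end).
rewrite comb_famcat; apply: (scalerI cmax).
have -> : c ord_max *: bP k = comb b' c' - comb y (fun j => c (lift ord_max j)).
  by rewrite -ec' combz addrC addKr.
rewrite scalerDr /comb !scaler_sumr -sumrN; congr (_ + _); apply: eq_bigr => j _.
  by rewrite (unsplitK (inl j)) scalerA mulrA divff // mul1r.
by rewrite (unsplitK (inr j)) scalerA mulrA divff // mul1r scaleNr.
Qed.

(** * Dimension as a number of leading coordinates *)

Section Pivots.
Variables (V : lmodType K) (T : eqType) (lt : rel T) (co : T -> V -> K).
Hypothesis colin : forall t a x y, co t (a *: x + y) = a * co t x + co t y.
Hypothesis ltasym : forall t t', lt t t' -> ~~ lt t' t.
Variable P : V -> Prop.
Hypothesis sP : subspace P.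

(** The leading coordinate is the smallest one for [lt] with a nonzero value, not the largest. *)
Definition leads t :=
  exists2 x, P x & co t x <> 0 /\ forall t', lt t' t -> co t' x = 0.

(** Filter [P] by the vanishing of the first coordinates of [s]. Imposing one more coordinate [t]
    lowers the dimension by one if [t] leads some element of [P], and changes nothing otherwise. *)
Lemma hasdim_leads (s : seq T) : pairwise lt s ->
  (forall x t, P x -> t \notin s -> co t x = 0) ->
  (forall x, P x -> (forall t, t \in s -> co t x = 0) -> x = 0) ->
  hasdim P (count (fun t => asbool (leads t)) s).
Proof.
move=> srt out sep.
pose Z (s1 : seq T) x := P x /\ forall t, t \in s1 -> co t x = 0.
suff main s1 s2 : s = s1 ++ s2 ->
    hasdim (Z s1) (count (fun t => asbool (leads t)) s2).
  apply: hasdim_ext (main [::] s erefl) => x; split=> [[]|] //.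
elim: s2 s1 => [|t s2 IH] s1 es.
  exists (fun k => 0); split=> [[]//|c _ []//|x [Px x0]].
  exists (fun=> 0); rewrite /comb big_ord0; apply: sep => // t.
  by rewrite es cats0; exact: x0.
have [|b [Zb fb sb]] := IH (rcons s1 t); first by rewrite es cat_rcons.
have lts1 t' : t' \in s1 -> lt t' t.
  move: srt; rewrite es pairwise_cat => /and3P[/allrelP H _ _] t's1.
  by apply: H => //; rewrite inE eqxx.
have nlts2 t' : t' \in s2 -> lt t t'.
  move: srt; rewrite es pairwise_cat => /and3P[_ _ /= /andP[/allP H _]].
  exact: H.
have Zsub x : Z s1 x -> co t x = 0 -> Z (rcons s1 t) x.
  case=> Px x0 xt; split=> // t'; rewrite mem_rcons inE => /orP[/eqP->//|].
  exact: x0.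
rewrite /=; case: asboolP => [[x Px [xt x0]]|nlead]; last first.
  exists b; split=> // [k|y Zy].
    by case: (Zb k) => Pb b0; split=> // t' t's1; apply: b0; rewrite mem_rcons inE t's1 orbT.
  apply: sb; apply: Zsub => //; apply: contrapT => yt; case: Zy => Py y0.
  (* A coordinate below [t] lies in the prefix [s1], where [y] vanishes, or outside [s], where all
     of [P] vanishes. *)
  apply: nlead; exists y => //; split=> // t' lt't.
  have [|/(out _ _ Py)//] := boolP (t' \in s).
  rewrite es mem_cat inE => /or3P[/y0//|/eqP e|/nlts2 lt'].
    by move: lt't (ltasym lt't); rewrite e => ->.
  by move: (ltasym lt't); rewrite lt'.
pose b1 (k : 'I_(1 + _)) := match split k with inl _ => x | inr j => b j end.
have combb1 c : comb b1 c = c (lshift _ 0) *: x + comb b (fun j => c (rshift 1 j)).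
  by have := comb_famcat (fun _ : 'I_1 => x) b c; rewrite {2}/comb big_ord1.
have combt c : co t (comb b c) = 0.
  have : Z (rcons s1 t) (comb b c).
    apply: subspace_comb => //; split=> [|a y z [Py y0] [Pz z0]]; split.
    - exact: (proj1 sP).
    - by move=> t' _; have := colin t' (-1) 0 0; rewrite scaler0 add0r mulN1r addNr.
    - exact: (proj2 sP).
    - by move=> t' t'in; rewrite colin y0 ?z0 ?mulr0 ?addr0.
  by case=> _; apply; rewrite mem_rcons inE eqxx.
exists b1; split=> [k|c|y Zy].
- rewrite /b1; case: (split k) => [_|j].
    by split=> // t' /lts1; exact: x0.
  by case: (Zb j) => Pb b0; split=> // t' t's1; apply: b0; rewrite mem_rcons inE t's1 orbT.
- rewrite combb1 => e.
  have c0 : c (lshift _ 0) = 0.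
    have := congr1 (co t) e; rewrite colin combt addr0.
    have -> : co t 0 = 0.
      by have := colin t (-1) 0 0; rewrite scaler0 add0r mulN1r addNr.
    by move/eqP; rewrite mulf_eq0 => /orP[/eqP//|/eqP].
  move: e; rewrite c0 scale0r add0r => /fb cj k.
  by rewrite -(splitK k); case: (split k) => i; rewrite /= ?(ord1 i) //; exact: cj.
- pose a := co t y / co t x.
  have xt' : co t x != 0 by apply/eqP.
  have [|c ec] := sb (- a *: x + y).
    case: Zy => Py y0; apply: Zsub; last by rewrite colin mulNr divfK // addNr.
    split; first exact: (proj2 sP).
    by move=> t' t's1; rewrite colin y0 // x0 ?mulr0 ?addr0 //; exact: lts1.
  exists (fun k => match split k with inl _ => a | inr j => c j end).
  rewrite combb1 (unsplitK (inl _)) -[y](addNKr (a *: x)) -scaleNr ec.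
  congr (_ + _); apply: eq_bigr => j _.
  by rewrite (unsplitK (inr j)).
Qed.

End Pivots.
End Dim.

(** * Hilbert series as integer sequences *)

Section IntegerSequences.
Implicit Types (h f g : int -> int) (us : seq int).

(** On generating series sum_j h_j t^j this is multiplication by 1 - t^u, so [deltas us] turns a
    Hilbert function into the coefficients of K. *)
Definition delta (u : int) h (j : int) := h j - h (j - u).
Definition deltas us h := foldr delta h us.

Lemma delta_ext u h h' : h =1 h' -> delta u h =1 delta u h'.
Proof. by move=> e j; rewrite /delta !e. Qed.

Lemma deltas_ext us h h' : h =1 h' -> deltas us h =1 deltas us h'.
Proof. by move=> e; elim: us => //= u us IH j; rewrite /delta !IH. Qed.

Lemma deltasC us u h : deltas us (delta u h) =1 delta u (deltas us h).
Proof.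
by elim: us => //= w us IH j; rewrite /delta !IH /delta (addrAC j (- w)); ring.
Qed.

Lemma deltasD us h h' j :
  deltas us (fun j => h j + h' j) j = deltas us h j + deltas us h' j.
Proof. by elim: us j => //= w us IH j; rewrite /delta !IH; ring. Qed.

Lemma deltasN us h j : deltas us (fun j => - h j) j = - deltas us h j.
Proof. by elim: us j => //= w us IH j; rewrite /delta !IH; ring. Qed.

Lemma deltasB us h h' j :
  deltas us (fun j => h j - h' j) j = deltas us h j - deltas us h' j.
Proof. by rewrite deltasD deltasN. Qed.

Lemma deltas_shift us h s j : deltas us (fun j => h (j - s)) j = deltas us h (j - s).
Proof. by elim: us j => //= w us IH j; rewrite /delta !IH (addrAC j (- w)). Qed.

Lemma deltas0 us j : deltas us (fun=> 0) j = 0.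
Proof. by elim: us j => //= w us IH j; rewrite /delta !IH subr0. Qed.

Lemma deltas_sum us (I : Type) (r : seq I) (F : I -> int -> int) j :
  deltas us (fun j => \sum_(i <- r) F i j) j = \sum_(i <- r) deltas us (F i) j.
Proof.
elim: r j => [|i r IH] j.
  by rewrite big_nil -[RHS](deltas0 us j); apply: deltas_ext => k; rewrite big_nil.
rewrite big_cons -IH -deltasD; apply: deltas_ext => k; exact: big_cons.
Qed.

(** * Laurent polynomials as finitely supported sequences *)

Definition fsupp f (N : nat) := forall j, N%:Z < `|j| -> f j = 0.

(** The sum over -N <= j <= N, indexed as in [chi_is]. *)
Definition ssum (N : nat) f : int := \sum_(0 <= k < N.*2.+1) f (k%:Z - N%:Z).

Lemma fsupp_le f N M : (N <= M)%N -> fsupp f N -> fsupp f M.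
Proof. by move=> NM fN j jM; apply: fN; lia. Qed.

Lemma ssum_le f N M : (N <= M)%N -> fsupp f N -> ssum M f = ssum N f.
Proof.
move=> NM fN; rewrite -(subnK NM); elim: (M - N)%N => // d <-.
rewrite addSn /ssum doubleS big_nat_recl // big_nat_recr //= [f (0 - _)]fN; last by lia.
rewrite [f (_ - _)]fN ?add0r ?addr0; last by lia.
apply: eq_bigr => k _; congr f; lia.
Qed.

(* [f], read as the Laurent polynomial sum_j f_j t^j, has value [r] and
   derivative [x] at t = 1. *)
Definition laurent f r x := exists N : nat,
  [/\ fsupp f N, ssum N f = r & ssum N (fun j => j * f j) = x].

Lemma laurent_ext f g r x : f =1 g -> laurent f r x -> laurent g r x.
Proof.
move=> e [N [fN s1 s2]]; exists N; split=> [j /fN <-|//|].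
- by rewrite e.
- by rewrite -s1; apply: eq_bigr => k _; rewrite e.
- by rewrite -s2; apply: eq_bigr => k _; rewrite e.
Qed.

Lemma fsupp_mulj f N : fsupp f N -> fsupp (fun j => j * f j) N.
Proof. by move=> fN j /fN ->; rewrite mulr0. Qed.

Lemma laurentD f g r x s y :
  laurent f r x -> laurent g s y -> laurent (fun j => f j + g j) (r + s) (x + y).
Proof.
move=> [N [fN f1 f2]] [M [gM g1 g2]]; exists (maxn N M).
have NL := leq_maxl N M; have ML := leq_maxr N M.
split=> [j jL||].
- by rewrite (fsupp_le NL fN) // (fsupp_le ML gM).
- by rewrite -f1 -g1 -(ssum_le NL fN) -(ssum_le ML gM) -big_split.
- rewrite -f2 -g2 -(ssum_le NL (fsupp_mulj fN)) -(ssum_le ML (fsupp_mulj gM)).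
  by rewrite -big_split; apply: eq_bigr => k _; rewrite mulrDr.
Qed.

Lemma laurentN f r x : laurent f r x -> laurent (fun j => - f j) (- r) (- x).
Proof.
move=> [N [fN <- <-]]; exists N; split=> [j /fN ->||]; first by rewrite oppr0.
  by rewrite /ssum sumrN.
by rewrite /ssum -sumrN; apply: eq_bigr => k _; rewrite mulrN.
Qed.

Lemma laurentB f g r x s y :
  laurent f r x -> laurent g s y -> laurent (fun j => f j - g j) (r - s) (x - y).
Proof. by move=> lf /laurentN lg; exact: laurentD. Qed.

Lemma laurent0 : laurent (fun=> 0) 0 0.
Proof. by exists 0%N; split=> //; rewrite /ssum big1 // => k; rewrite mulr0. Qed.

Lemma laurent_sum (I : Type) (l : seq I) (F : I -> int -> int) (r x : I -> int) :
  (forall i, laurent (F i) (r i) (x i)) ->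
  laurent (fun j => \sum_(i <- l) F i j) (\sum_(i <- l) r i) (\sum_(i <- l) x i).
Proof.
move=> HF; elim: l => [|i l IH].
  by rewrite !big_nil; apply: laurent_ext laurent0 => j; rewrite big_nil.
rewrite !big_cons; apply: laurent_ext (laurentD (HF i) IH) => j.
by rewrite big_cons.
Qed.

Lemma laurent_delta (s : int) : laurent (fun j => (j == s)%:R) 1 s.
Proof.
have fs : fsupp (fun j => (j == s)%:R) `|s|%N by move=> j js; case: eqP => //; lia.
have key (w : int -> int) : ssum (absz s) (fun j => w j * (j == s)%:R) = w s.
  have lt : (absz (s + (absz s)%:Z)%R < (absz s).*2.+1)%N by lia.
  rewrite /ssum big_mkord (bigD1 (Ordinal lt)) //= big1 ?addr0 => [|k nk].
    have -> : ((absz (s + (absz s)%:Z))%:Z - (absz s)%:Z) = s by lia.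
    by rewrite eqxx mulr1.
  case: eqP => [e|]; last by rewrite mulr0.
  by move: nk; rewrite -val_eqE /= => /eqP[]; lia.
exists (absz s); split; [exact: fs| |exact: (key id)].
by rewrite -[RHS](key (fun=> 1)); apply: eq_bigr => k _; rewrite mul1r.
Qed.

Lemma laurent_fsupp f N : fsupp f N -> laurent f (ssum N f) (ssum N (fun j => j * f j)).
Proof. by exists N. Qed.

(** * Positivity of K near t = 1 *)

Definition evneg f := exists N : nat, forall j, N%:Z <= j -> f j <= -1.

(** Along each residue class modulo [u], the sequence eventually drops by at least one per step, so
    it tends to minus infinity. *)
Lemma evneg_undelta u h : 0 < u -> evneg (delta u h) -> evneg h.
Proof.
move=> u0 [N hN].
have step q j : N%:Z <= j -> h (j + q%:Z * u) <= h j - q%:Z.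
  move=> jN; elim: q => [|q IH]; first by rewrite mul0r addr0 subr0.
  have : delta u h (j + q.+1%:Z * u) <= -1 by apply: hN; nia.
  rewrite /delta.
  have -> : j + q.+1%:Z * u - u = j + q%:Z * u by lia.
  by move: IH; lia.
have [B hB] : exists B : nat, forall k : nat, (k < `|u|)%N -> h (N%:Z + k%:Z) <= B%:Z.
  elim: `|u|%N => [|m [B hB]]; first by exists 0%N.
  exists (B + absz (h (N%:Z + m%:Z)%R))%N => k; rewrite ltnS leq_eqVlt => /orP[/eqP->|/hB]; lia.
(* [B] bounds [h] on the period starting at [N]; after [B.+1] further periods the value is at most
   [B - B.+1], that is, -1. *)
exists (N + `|u| * B.+1)%N => j hj.
pose q := (absz (j - N%:Z) %/ `|u|)%N; pose k := (absz (j - N%:Z) %% `|u|)%N.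
have ku : (k < `|u|)%N by rewrite ltn_mod; lia.
have ej : j = N%:Z + k%:Z + q%:Z * u.
  have := divn_eq (absz (j - N%:Z)) `|u|; rewrite -/q -/k => e.
  have ju : N%:Z <= j by lia.
  have : (absz (j - N%:Z))%:Z = q%:Z * `|u|%N%:Z + k%:Z by rewrite e; lia.
  have -> : `|u|%N%:Z = u by lia.
  lia.
have qB : (B < q)%N by rewrite leq_divRL; lia.
rewrite ej (le_trans (step _ _ _)) //; first by lia.
by have := hB _ ku; lia.
Qed.

Lemma evneg_undeltas us h : (forall u, u \in us -> 0 < u) ->
  evneg (deltas us h) -> evneg h.
Proof.
elim: us => //= u us IH u0 /evneg_undelta ev; apply: IH => [w wus|].
  by apply: u0; rewrite inE wus orbT.
by apply: ev; apply: u0; rewrite inE eqxx.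
Qed.

(** Division of the series by 1 - t, for sequences vanishing below [-a]. The guard is essential:
    [absz] would fold the smaller arguments back to positive ones. *)
Definition psum (a : nat) h (j : int) : int :=
  if j < - a%:Z then 0 else \sum_(0 <= k < (absz (j + a%:Z)).+1) h (k%:Z - a%:Z).

Lemma delta_psum a h : (forall j, j < - a%:Z -> h j = 0) -> delta 1 (psum a h) =1 h.
Proof.
move=> h0 j; rewrite /delta /psum; case: ltP => ja.
  by rewrite ifT ?h0 //; lia.
have [{}ja|->] : (- a%:Z < j) \/ j = - a%:Z by lia.
  rewrite ifF; last by lia.
  have -> : absz (j + a%:Z) = (absz (j - 1 + a%:Z)).+1 by lia.
  by rewrite big_nat_recr //= addrAC subrr add0r; congr h; lia.
by rewrite ifT ?subr0; [rewrite addNr big_nat1; congr h; lia|lia].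
Qed.

Lemma psum_lt a h j : j < - a%:Z -> psum a h j = 0.
Proof. by rewrite /psum => ->. Qed.

Lemma psum_ge0 a h : (forall j, 0 <= h j) -> forall j, 0 <= psum a h j.
Proof. by move=> h0 j; rewrite /psum; case: ifP => // _; exact: sumr_ge0. Qed.

Lemma deltas_lt us h (a : nat) : (forall u, u \in us -> 0 < u) ->
  (forall j, j < - a%:Z -> h j = 0) -> forall j, j < - a%:Z -> deltas us h j = 0.
Proof.
move=> u0 h0; elim: us u0 => //= u us IH u0 j ja.
have us0 : forall w, w \in us -> 0 < w by move=> w wus; apply: u0; rewrite inE wus orbT.
have : 0 < u by apply: u0; rewrite inE eqxx.
by move=> ugt0; rewrite /delta !IH ?subr0 //; lia.
Qed.

(** The weights are the coefficients of 1 / (1 - t)^2 = sum_m (m + 1) t^m. *)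
Lemma delta2_closed (a : nat) f g : (forall j, j < - a%:Z -> g j = 0) ->
  delta 1 (delta 1 g) =1 f ->
  forall n : nat, g (n%:Z - a%:Z) = \sum_(0 <= k < n.+1) (n%:Z - k%:Z + 1) * f (k%:Z - a%:Z).
Proof.
move=> g0 e.
have e1 (n : nat) : delta 1 g (n%:Z - a%:Z) = \sum_(0 <= k < n.+1) f (k%:Z - a%:Z).
  elim: n => [|n IH].
    have z1 : g (0 - a%:Z - 1) = 0 by apply: g0; lia.
    have z2 : g (0 - a%:Z - 1 - 1) = 0 by apply: g0; lia.
    by rewrite big_nat1 -e /delta z1 z2 !subr0.
  rewrite big_nat_recr //= -IH -e [X in _ = _ + X]/delta.
  have -> : n.+1%:Z - a%:Z - 1 = n%:Z - a%:Z by lia.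
  by rewrite addrCA subrr addr0.
elim=> [|n IH].
  rewrite big_nat1 subrr add0r mul1r.
  have z1 : g (0 - a%:Z - 1) = 0 by apply: g0; lia.
  by have := e1 0%N; rewrite big_nat1 /delta z1 subr0 sub0r.
have := e1 n.+1; rewrite /delta.
have -> : n.+1%:Z - a%:Z - 1 = n%:Z - a%:Z by lia.
rewrite IH => /eqP; rewrite subr_eq => /eqP ->.
rewrite [in LHS]big_nat_recr //= [in RHS]big_nat_recr //= addrAC -big_split /=.
congr (_ + _); last by rewrite subrr add0r mul1r.
by apply: eq_bigr => k _; lia.
Qed.

(* Positivity near t = 1: K(t) = prod (1 - t^{u_i}) HP(t) cannot become negative
   as t tends to 1 from below.  Concretely, dividing K by (1 - t)^2 gives a
   sequence eventually equal to (j + 1) r - x. *)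
Lemma laurent_pos us h (a : nat) r x : (forall u, u \in us -> 0 < u) ->
  (forall j, 0 <= h j) -> (forall j, j < - a%:Z -> h j = 0) ->
  laurent (deltas us h) r x -> 0 <= r /\ (r = 0 -> x <= 0).
Proof.
move=> u0 h0 ha [N0 [fN0 s1 s2]].
pose N := maxn N0 a.
have fN := fsupp_le (leq_maxl N0 a : (N0 <= N)%N) fN0.
have {}s1 : ssum N (deltas us h) = r by rewrite (ssum_le (leq_maxl _ _) fN0).
have {}s2 : ssum N (fun j => j * deltas us h j) = x.
  by rewrite (ssum_le (leq_maxl _ _) (fsupp_mulj fN0)).
have {}ha j : j < - N%:Z -> h j = 0 by move=> jN; apply: ha; lia.
pose h2 := psum N (psum N h).
have h20 j : 0 <= h2 j by do 2 apply: psum_ge0.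
have d2 : delta 1 (delta 1 (deltas us h2)) =1 deltas us h.
  move=> j; rewrite -(delta_ext _ (deltasC us 1 h2)) -deltasC; apply: deltas_ext => i.
  by rewrite (delta_ext 1 (delta_psum (@psum_lt N h) : delta 1 h2 =1 _)) delta_psum.
have g0 j : j < - N%:Z -> deltas us h2 j = 0.
  by apply: deltas_lt => // i; exact: psum_lt.
(* From [2 * N] on, the convolution covers the whole support of K; its weights are affine in the
   index, so only the value [r] and the derivative [x] remain. *)
have ev (j : nat) : (2 * N <= j)%N -> deltas us h2 (j%:Z - N%:Z) = (j%:Z - N%:Z + 1) * r - x.
  move=> jN; rewrite (delta2_closed g0 d2) -s1 -s2 /ssum.
  rewrite mulr_sumr -sumrB (big_cat_nat _ (n := N.*2.+1)) //=; last by lia.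
  rewrite [X in _ + X]big_nat_cond [X in _ + X]big1 ?addr0 => [|k /andP[/andP[k1 k2] _]].
    by apply: eq_bigr => k _; ring.
  by rewrite fN ?mulr0 //; lia.
(* Dividing by 1 - t keeps coefficients nonnegative, so [h2] is not eventually negative. Both r < 0,
   and r = 0 with x > 0, would make it so. *)
have noev : ~ evneg (deltas us h2).
  by case/(evneg_undeltas u0) => M hM; have := hM M%:Z (lexx _); have := h20 M%:Z; lia.
have evj j : N%:Z <= j -> deltas us h2 j = (j + 1) * r - x.
  move=> jN; have := ev (absz (j + N%:Z)).
  have -> : (absz (j + N%:Z))%:Z - N%:Z = j by lia.
  by apply; lia.
split.
  rewrite leNgt; apply/negP => r0; apply: noev; exists (N + `|x|.+1)%N => j jN.
  by rewrite evj; [nia|lia].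
move=> r0; rewrite leNgt; apply/negP => x0; apply: noev; exists N => j jN.
by rewrite evj // r0 mulr0; lia.
Qed.

(** * Counting monomials of given weight *)

Fixpoint swt us (s : seq nat) : int :=
  match us, s with u :: us', a :: s' => u * a%:Z + swt us' s' | _, _ => 0 end.

(** With positive weights an exponent [a] occurring in weight [j] satisfies a <= u a <= j, whence
    the range up to [absz j]. For negative [j] the remaining weight stays negative and every
    candidate is discarded at the end. *)
Fixpoint mons us (j : int) : seq (seq nat) :=
  if us is u :: us' then
    flatten [seq [seq a :: s | s <- mons us' (j - u * a%:Z)] | a <- iota 0 (absz j).+1]
  else if j == 0 then [:: [::]] else [::].

Lemma mons_cons u us j : mons (u :: us) j =
  flatten [seq [seq a :: s | s <- mons us (j - u * a%:Z)] | a <- iota 0 (absz j).+1].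
Proof. by []. Qed.

Lemma swt_ge0 us s : (forall u, u \in us -> 0 < u) -> 0 <= swt us s.
Proof.
elim: us s => [|u us IH] [|a s] //= u0.
have : 0 < u by apply: u0; rewrite inE eqxx.
have := IH s (fun w wus => u0 w (mem_behead (s := u :: us) wus)).
by move=> *; nia.
Qed.

Lemma mem_mons us j s : (forall u, u \in us -> 0 < u) ->
  (s \in mons us j) = (size s == size us) && (swt us s == j).
Proof.
elim: us j s => [|u us IH] j s u0.
  by rewrite /= [0 == j]eq_sym; case: (j == 0); case: s.
have ugt0 : 0 < u by apply: u0; rewrite inE eqxx.
have us0 : forall w, w \in us -> 0 < w by move=> w wus; apply: u0; rewrite inE wus orbT.
rewrite mons_cons; apply/flatten_mapP/andP => [[a _ /mapP[s' + ->]]|].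
  by rewrite IH //= => /andP[/eqP-> /eqP->]; split=> //; apply/eqP; lia.
case: s => [[]//|a s [/eqP[sz] /= /eqP e]].
have wt0 := swt_ge0 s us0.
exists a; last by apply: map_f; rewrite IH // sz eqxx /=; apply/eqP; lia.
have : (a < (absz j).+1)%N by nia.
by rewrite -[(a < _)%N]andTb -[true]/(0 <= a)%N -[X in (_ < X)%N]add0n -mem_iota.
Qed.

Lemma uniq_mons us j : uniq (mons us j).
Proof.
elim: us j => [|u us IH] j; first by rewrite /=; case: ifP.
rewrite mons_cons.
elim: (iota _ _) (iota_uniq 0 (absz j).+1) => //= a l IHl /andP[al /IHl].
rewrite cat_uniq => ->; rewrite map_inj_uniq ?IH ?andbT //= => [|s s' []//].
apply/hasPn => s /flatten_mapP[b bl /mapP[s' _ ->]].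
by apply/mapP => -[s'' _ [e]]; move: al; rewrite -e bl.
Qed.

Definition cnt us (U : pred (seq nat)) (j : int) : int := (count U (mons us j))%:Z.

Lemma mons_neg us j : (forall u, u \in us -> 0 < u) -> j < 0 -> mons us j = [::].
Proof.
move=> u0 j0; case e : (mons us j) => [//|s l].
have : s \in mons us j by rewrite e inE eqxx.
by rewrite mem_mons // => /andP[_ /eqP e']; have := swt_ge0 s u0; lia.
Qed.

Lemma cnt_neg us U j : (forall u, u \in us -> 0 < u) -> j < 0 -> cnt us U j = 0.
Proof. by move=> u0 j0; rewrite /cnt mons_neg. Qed.

Lemma cnt_cons u us U j M : 0 < u -> (forall u, u \in us -> 0 < u) ->
  (absz j < M)%N ->
  cnt (u :: us) U j = \sum_(0 <= a < M) cnt us (fun s => U (a :: s)) (j - u * a%:Z).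
Proof.
move=> ugt0 u0 jM; rewrite (big_cat_nat _ (n := (absz j).+1)) //=.
rewrite [X in _ + X]big_nat_cond [X in _ + X]big1 ?addr0 => [|a /andP[/andP[a1 _] _]].
  rewrite /cnt mons_cons; elim: (absz j).+1 => [|m IH]; first by rewrite big_nil.
  rewrite big_nat_recr // -IH -[m.+1]addn1 iotaD add0n map_cat flatten_cat count_cat PoszD.
  by rewrite /= cats0 count_map.
by rewrite cnt_neg //; nia.
Qed.

(** * Up-sets of N^k *)

Definition upset (k : nat) (U : pred (seq nat)) := forall s s',
  size s = k -> size s' = k -> all2 leq s s' -> U s -> U s'.

Lemma all2_refl s : all2 leq s s.
Proof. by elim: s => //= a s ->; rewrite leqnn. Qed.

Lemma upset_slice k U a : upset k.+1 U -> upset k (fun s => U (a :: s)).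
Proof.
move=> UU s s' sz sz' le; apply: UU; rewrite /= ?sz ?sz' //.
by rewrite leqnn.
Qed.

Lemma upset_slice_le k U a b s : upset k.+1 U -> size s = k -> (a <= b)%N ->
  U (a :: s) -> U (b :: s).
Proof.
by move=> UU sz ab; apply: UU; rewrite /= ?sz //= ab all2_refl.
Qed.

(* Dickson's lemma as an ascending chain condition.  In the inductive step the
   diagonal chain of slices settles all but finitely many slices at once. *)
Lemma upset_acc k (C : nat -> pred (seq nat)) :
  (forall a, upset k (C a)) ->
  (forall a b s, size s = k -> (a <= b)%N -> C a s -> C b s) ->
  exists A, forall a s, (A <= a)%N -> size s = k -> C a s = C A s.
Proof.
elim: k C => [|k IH] C Cup Cinc.
  have [[A CA]|nC] := EM (exists A, C A [::]).
    exists A => a s Aa /size0nil ->; rewrite CA; exact: Cinc CA.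
  exists 0%N => a s _ /size0nil ->; apply/idP/idP => H; case: nC; by [exists a|exists 0%N].
have CC a b c d s : size s = k -> (a <= c)%N -> (b <= d)%N ->
    C a (b :: s) -> C c (d :: s).
  move=> sz ac bd Cab; apply: (Cinc a) => //; first by rewrite /= sz.
  exact: upset_slice_le (Cup a) sz bd Cab.
(* The diagonal slices form an ascending chain in one variable less. *)
have [||A hA] := IH (fun a s => C a (a :: s)).
- by move=> a; exact: upset_slice (Cup a).
- by move=> a b s sz ab; exact: CC.
have stab b : exists B, forall a s, (B <= a)%N -> size s = k -> C a (b :: s) = C B (b :: s).
  apply: (IH (fun a s => C a (b :: s))) => [a|a c s sz ac]; first exact: upset_slice (Cup a).
  exact: CC.
have [B hB] : exists B, forall b a s, (b < A)%N -> (B <= a)%N -> size s = k ->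
    C a (b :: s) = C B (b :: s).
  elim: {hA} A => [|A [B hB]]; first by exists 0%N.
  have [B' hB'] := stab A; exists (maxn B B') => b a s.
  rewrite ltnS leq_eqVlt geq_max => /orP[/eqP->|bA] /andP[Ba B'a] sz.
    by rewrite hB' // [RHS]hB' // leq_maxr.
  by rewrite hB // [RHS]hB // leq_maxl.
exists (maxn A B) => a [//|b s]; rewrite geq_max => /andP[Aa Ba] [sz].
have [bA|Ab] := ltnP b A.
  by rewrite hB // [RHS]hB // leq_maxr.
(* For [b] and [c] at least [A], the slice [C c (b :: s)] is caught between the diagonal slices at
   [A] and at [maxn b c], which agree. *)
have big c : (A <= c)%N -> C c (b :: s) = C A (A :: s).
  move=> Ac; apply/idP/idP => H; last exact: CC H.
  rewrite -(hA (maxn b c)) // ?(leq_trans Ac) ?leq_maxr //.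
  by apply: CC H; rewrite ?leq_maxr ?leq_maxl.
by rewrite !big // leq_maxl.
Qed.

(** * K is a Laurent polynomial for counting functions of up-sets *)

Definition good us h := exists N, fsupp (deltas us h) N.

Lemma good_ext us h h' : h =1 h' -> good us h -> good us h'.
Proof. by move=> e [N hN]; exists N => j /hN <-; apply: deltas_ext => i; rewrite e. Qed.

Lemma goodP us h : good us h <-> exists r x, laurent (deltas us h) r x.
Proof.
split=> [[N hN]|[r [x [N [hN _ _]]]]]; last by exists N.
by do 2 eexists; exact: laurent_fsupp hN.
Qed.

Lemma goodD us h h' : good us h -> good us h' -> good us (fun j => h j + h' j).
Proof.
move=> [N hN] [M hM]; exists (maxn N M) => j jL.
by rewrite deltasD (fsupp_le (leq_maxl N M) hN) // (fsupp_le (leq_maxr N M) hM).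
Qed.

Lemma goodN us h : good us h -> good us (fun j => - h j).
Proof. by move=> [N hN]; exists N => j jL; rewrite deltasN hN ?oppr0. Qed.

Lemma good_shift us h s : good us h -> good us (fun j => h (j - s)).
Proof.
move=> [N hN]; exists (N + absz s)%N => j jL; rewrite deltas_shift hN //.
lia.
Qed.

Lemma good_sum us (I : Type) (l : seq I) (F : I -> int -> int) :
  (forall i, good us (F i)) -> good us (fun j => \sum_(i <- l) F i j).
Proof.
move=> HF; elim: l => [|i l IH].
  by exists 0%N => j _; rewrite deltas_sum big_nil.
by apply: good_ext (goodD (HF i) IH) => j; rewrite big_cons.
Qed.

Lemma cnt_ext us U U' j : (forall u, u \in us -> 0 < u) ->
  (forall s, size s = size us -> U s = U' s) -> cnt us U j = cnt us U' j.
Proof.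
move=> u0 UU'; congr Posz; apply: eq_in_count => s.
by rewrite mem_mons // => /andP[/eqP/UU'].
Qed.

(** Abel summation: with C_a the series of the slice of first exponent a, (1 - t^u) sum_a t^{ua} C_a
    = C_0 + sum_a t^{u(a+1)} (C_{a+1} - C_a). Any [M] beyond the possible exponents truncates the
    sum harmlessly. *)
Lemma delta_cnt u us U j M : 0 < u -> (forall u, u \in us -> 0 < u) ->
  (absz j < M)%N -> (absz (j - u) < M)%N ->
  delta u (cnt (u :: us) U) j = cnt us (fun s => U (0%N :: s)) j +
  \sum_(0 <= a < M) (cnt us (fun s => U (a.+1 :: s)) (j - u * a.+1%:Z)
    - cnt us (fun s => U (a :: s)) (j - u * a.+1%:Z)).
Proof.
move=> ugt0 u0 M1 M2; rewrite /delta (cnt_cons U ugt0 u0 (ltnW M1 : (absz j < M.+1)%N)).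
rewrite (cnt_cons U ugt0 u0 M2) big_nat_recl //= mulr0 subr0 sumrB addrA.
congr (_ + _ - _); apply: eq_bigr => a _; congr cnt; lia.
Qed.

(** The slices of an up-set increase and become stationary at some [A], so after Abel summation only
    finitely many terms survive, each a shifted series in one variable less. *)
Lemma good_upset us U : (forall u, u \in us -> 0 < u) -> upset (size us) U ->
  good us (cnt us U).
Proof.
elim: us U => [|u us IH] U u0 UU.
  by exists 0%N => j j0; rewrite /= /cnt /=; case: eqP j0 => // ->.
have ugt0 : 0 < u by apply: u0; rewrite inE eqxx.
have us0 : forall w, w \in us -> 0 < w by move=> w wus; apply: u0; rewrite inE wus orbT.
have [||A hA] := @upset_acc (size us) (fun a s => U (a :: s)).
- by move=> a; exact: upset_slice.
- by move=> a b s; exact: upset_slice_le.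
pose F j := cnt us (fun s => U (0%N :: s)) j +
  \sum_(0 <= a < A) (cnt us (fun s => U (a.+1 :: s)) (j - u * a.+1%:Z)
    - cnt us (fun s => U (a :: s)) (j - u * a.+1%:Z)).
have gcnt a s : good us (fun j => cnt us (fun s => U (a :: s)) (j - s)).
  by apply: good_shift; apply: IH => //; exact: upset_slice.
have goodF : good us F.
  apply: goodD; first by apply: good_ext (gcnt 0%N 0) => j; rewrite subr0.
  by apply: good_sum => a; apply: goodD; [|apply: goodN]; exact: gcnt.
have [N hN] := goodF; exists N => j /hN <-.
rewrite /= -deltasC; apply: deltas_ext => i.
rewrite (@delta_cnt _ _ _ _ (A + (absz i).+1 + (absz (i - u)).+1)) //; try lia.
rewrite (big_cat_nat _ (n := A)) //=; last by lia.
rewrite [X in _ + (_ + X)]big_nat_cond [X in _ + (_ + X)]big1 ?addr0 //.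
move=> a /andP[/andP[Aa _] _]; apply/eqP; rewrite subr_eq0; apply/eqP.
by apply: cnt_ext => // s sz; rewrite !hA //; lia.
Qed.

(** The Hilbert series of the polynomial ring is 1 / prod_i (1 - t^{u_i}): all slices coincide, so
    the Abel sum reduces to its first term. *)
Lemma deltas_cnt us j : (forall u, u \in us -> 0 < u) ->
  deltas us (cnt us predT) j = (j == 0)%:R.
Proof.
elim: us j => [|u us IH] j u0 /=; first by rewrite /cnt /=; case: eqP.
have ugt0 : 0 < u by apply: u0; rewrite inE eqxx.
have us0 : forall w, w \in us -> 0 < w by move=> w wus; apply: u0; rewrite inE wus orbT.
rewrite -deltasC -IH //; apply: deltas_ext => i.
rewrite (@delta_cnt _ _ _ _ ((absz i).+1 + (absz (i - u)).+1)) //; try lia.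
by rewrite big1 ?addr0 // => a _; rewrite subrr.
Qed.

(** * The subset sum [hcoef] as an iterated difference *)

Section Hcoef.

(** The coefficient of t^j in p(t) sum_i h_i t^i: polynomials act on sequences by shifts. *)
Definition pact h (j : int) (p : {poly int}) : int :=
  \sum_(k < size p) p`_k * h (j - k%:Z).

Lemma pact_widen h j (p : {poly int}) m : (size p <= m)%N ->
  pact h j p = \sum_(k < m) p`_k * h (j - k%:Z).
Proof.
move=> pm; rewrite /pact (big_ord_widen _ (fun k => p`_k * h (j - k%:Z)) pm).
rewrite [RHS](bigID (fun k : 'I_m => (k < size p)%N)) /= [X in _ + X]big1 ?addr0 //.
by move=> k; rewrite -leqNgt => /(nth_default 0) ->; rewrite mul0r.
Qed.

Lemma pactD h j p q : pact h j (p + q) = pact h j p + pact h j q.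
Proof.
pose m := maxn (size p) (size q).
rewrite !(@pact_widen _ _ _ m) ?leq_maxl ?leq_maxr ?size_polyD // -big_split /=.
by apply: eq_bigr => k _; rewrite coefD mulrDl.
Qed.

Lemma pactZ h j c p : pact h j (c *: p) = c * pact h j p.
Proof.
rewrite !(@pact_widen _ _ _ (size p)) ?size_scale_leq // mulr_sumr.
by apply: eq_bigr => k _; rewrite coefZ mulrA.
Qed.

Lemma pactXn h j (m : nat) : pact h j 'X^m = h (j - m%:Z).
Proof.
rewrite /pact size_polyXn big_ord_recr /= coefXn eqxx mul1r big1 ?add0r // => k _.
by rewrite coefXn ltn_eqF ?mul0r.
Qed.

Lemma pact_mulXn h j m p : pact h j ('X^m * p) = pact h (j - m%:Z) p.
Proof.
elim/poly_ind: p m j => [|p c IH] m j.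
  by rewrite mulr0 /pact size_poly0 !big_ord0.
rewrite mulrDr mulrCA -exprSr mulrC pactD [RHS]pactD IH [p * 'X]mulrC -['X]expr1 IH.
rewrite -['X^m * _]mulrC mul_polyC pactZ pactXn -[in RHS](mulr1 c%:P) mul_polyC pactZ.
rewrite -(expr0 'X) pactXn subr0; congr (_ + _); congr pact; lia.
Qed.

Lemma pact_prod h us j : (forall u, u \in us -> 0 < u) ->
  pact h j (\prod_(u <- us) (1 - 'X^(absz u))) = deltas us h j.
Proof.
elim: us j => [|u us IH] j u0.
  by rewrite big_nil /= -(expr0 'X) pactXn subr0.
have ugt0 : 0 < u by apply: u0; rewrite inE eqxx.
rewrite big_cons mulrBl mul1r pactD -scaleN1r pactZ mulN1r pact_mulXn /= /delta.
by rewrite !IH ?gtz0_abs // => w wus; apply: u0; rewrite inE wus orbT.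
Qed.

(** One polynomial prod_i (1 - X^{u_i}) acts on both sides: factor by factor it gives [deltas],
    expanded over subsets it gives [hcoef]. *)
Lemma hcoef_deltas n (u : 'I_n -> int) (H : int -> nat) j : (forall i, 0 < u i) ->
  hcoef u H j = deltas [seq u i | i <- enum 'I_n] (fun i => (H i)%:Z) j.
Proof.
move=> u0; rewrite -pact_prod => [|w /mapP[i _ ->] //].
rewrite big_map enumT -/(index_enum _) /=.
under eq_bigr => i _ do rewrite addrC.
rewrite bigA_distr /=.
have pact_sum (I : Type) (l : seq I) (F : I -> {poly int}) :
    pact (fun i => (H i)%:Z) j (\sum_(i <- l) F i) = \sum_(i <- l) pact (fun i => (H i)%:Z) j (F i).
  elim: l => [|i l IH]; last by rewrite !big_cons pactD IH.
  by rewrite !big_nil /pact size_poly0 big_ord0.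
rewrite pact_sum; apply: eq_bigr => A _.
have -> : \prod_i (if i \in A then - 'X^(absz (u i)) else 1) =
    (-1) ^+ #|A| *: 'X^(\sum_(i in A) absz (u i)) :> {poly int}.
  rewrite -big_mkcond /= prodrN -mul_polyC rmorphXn rmorphN1 expr_sum.
  by congr (_ * _).
rewrite pactZ pactXn; congr (_ * (H _)%:Z); congr (_ - _).
rewrite -[RHS]natz natr_sum; apply: eq_bigr => i _.
by rewrite natz gtz0_abs.
Qed.

End Hcoef.

End IntegerSequences.

(** * Factoriality of polynomial rings *)

Section Divisibility.
Variable R : idomainType.
Implicit Types a b c p : R.

Definition rdvd a b := exists c, b = c * a.

Definition prime_elt p := [/\ p != 0, p \isn't a GRing.unit &
  forall a b, rdvd p (a * b) -> rdvd p a \/ rdvd p b].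

(** Factors are required to be prime rather than irreducible, so that existence of a factorization
    already carries uniqueness. *)
Definition prime_factored a := exists w ps, [/\ w \is a GRing.unit,
  forall p, p \in ps -> prime_elt p & a = w * \prod_(p <- ps) p].

Lemma rdvd_refl a : rdvd a a.
Proof. by exists 1; rewrite mul1r. Qed.

Lemma rdvd0 a : rdvd a 0.
Proof. by exists 0; rewrite mul0r. Qed.

Lemma rdvd_trans a b c : rdvd a b -> rdvd b c -> rdvd a c.
Proof. by move=> [d ->] [e ->]; exists (e * d); rewrite mulrA. Qed.

Lemma rdvd_mulr a b c : rdvd a b -> rdvd a (c * b).
Proof. by move=> [d ->]; exists (c * d); rewrite mulrA. Qed.

Lemma rdvd_mull a b c : rdvd a b -> rdvd a (b * c).
Proof. by move=> /rdvd_mulr; rewrite mulrC; exact. Qed.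

Lemma rdvdD a b c : rdvd a b -> rdvd a c -> rdvd a (b + c).
Proof. by move=> [d ->] [e ->]; exists (d + e); rewrite mulrDl. Qed.

Lemma rdvdN a b : rdvd a b -> rdvd a (- b).
Proof. by move=> [d ->]; exists (- d); rewrite mulNr. Qed.

Lemma rdvdB a b c : rdvd a b -> rdvd a c -> rdvd a (b - c).
Proof. by move=> ab /rdvdN ac; exact: rdvdD. Qed.

Lemma rdvd_addr a b c : rdvd a b -> rdvd a (b + c) -> rdvd a c.
Proof. by move=> ab abc; rewrite -(addrK b c) addrC addrC [c + b]addrC; exact: rdvdB. Qed.

Lemma rdvd_sum (I : Type) (l : seq I) (P : pred I) (F : I -> R) a :
  (forall i, P i -> rdvd a (F i)) -> rdvd a (\sum_(i <- l | P i) F i).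
Proof.
by move=> H; elim/big_rec: _ => [|i x /H ai ax]; [exact: rdvd0|exact: rdvdD].
Qed.

Lemma rdvd_mul2 a b c d : rdvd a b -> rdvd c d -> rdvd (a * c) (b * d).
Proof. by move=> [x ->] [y ->]; exists (x * y); rewrite mulrACA. Qed.

Lemma rdvd_exp a b n : rdvd a b -> rdvd (a ^+ n) (b ^+ n).
Proof. by move=> [x ->]; exists (x ^+ n); rewrite exprMn. Qed.

Lemma rdvd_exp_le a m n : (m <= n)%N -> rdvd (a ^+ m) (a ^+ n).
Proof. by move=> mn; exists (a ^+ (n - m)); rewrite -exprD subnK. Qed.

Lemma rdvd_unit a b : rdvd a b -> b \is a GRing.unit -> a \is a GRing.unit.
Proof. by move=> [c ->]; rewrite unitrM => /andP[]. Qed.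

Lemma prime_rdvd_sym p q : prime_elt p -> prime_elt q -> rdvd p q -> rdvd q p.
Proof.
move=> [p0 pU _] [q0 qU qP] [s e].
have [[t et]|//] : rdvd q s \/ rdvd q p by apply: qP; rewrite -e; exact: rdvd_refl.
have : (t * p) * q = 1 * q by rewrite mul1r {2}e et mulrAC.
move/(mulIf q0) => tp; case/negP: pU; apply: (rdvd_unit (b := 1)); last exact: unitr1.
by exists t.
Qed.

Lemma prime_factoredM a b :
  prime_factored a -> prime_factored b -> prime_factored (a * b).
Proof.
move=> [w [ps [wU psP ->]]] [w' [ps' [wU' psP' ->]]]; exists (w * w'), (ps ++ ps').
split; first by rewrite unitrM wU.
  by move=> p; rewrite mem_cat => /orP[/psP|/psP'].
by rewrite big_cat mulrACA.
Qed.

Lemma prime_factored_unit a : a \is a GRing.unit -> prime_factored a.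
Proof. by move=> aU; exists a, [::]; rewrite big_nil mulr1. Qed.

Lemma prime_factored_prime p : prime_elt p -> prime_factored p.
Proof.
move=> pP; exists 1, [:: p]; split; first exact: unitr1.
  by move=> q; rewrite inE => /eqP->.
by rewrite big_seq1 mul1r.
Qed.

End Divisibility.

(** * Gauss's lemma and factoriality of R[X] *)

Definition factorial_ring (R : idomainType) :=
  forall a : R, a != 0 -> prime_factored a.

Section PolyFactorial.
Variable R : idomainType.
Hypothesis factR : factorial_ring R.
Implicit Types f g q : {poly R}.

Lemma rdvd_polyC (c : R) f : rdvd c%:P f <-> forall i, rdvd c f`_i.
Proof.
split=> [[g ->] i|/choice[g hg]].
  by exists g`_i; rewrite coefMC.
exists (\poly_(i < size f) g i); apply/polyP => i; rewrite coefMC coef_poly.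
by case: ltnP => [_|/(nth_default 0) ->]; rewrite ?mul0r -?hg.
Qed.

(** Gauss's lemma, by induction from the constant terms: [p] divides their product, hence one of
    them; that term can be removed and the factor divided by X. *)
Lemma prime_polyC (p : R) : prime_elt p -> prime_elt p%:P.
Proof.
move=> [p0 pU pP]; split; rewrite ?polyC_eq0 ?poly_unitE ?size_polyC ?p0 ?coefC ?eqxx //.
have cons f (a : R) : rdvd p%:P f -> rdvd p a -> rdvd p%:P (f * 'X + a%:P).
  by move=> pf [b ->]; apply: rdvdD; [exact: rdvd_mull|exists b%:P; rewrite polyCM].
have mulX f : rdvd p%:P (f * 'X) -> rdvd p%:P f.
  by move=> /rdvd_polyC pf; apply/rdvd_polyC => i; have := pf i.+1; rewrite coefMX.
elim/poly_ind => [|f a IHf] g; first by left; exact: rdvd0.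
elim/poly_ind: g => [|g b IHg] dvd; first by right; exact: rdvd0.
have : rdvd p (a * b).
  have /rdvd_polyC/(_ 0%N) := dvd.
  by rewrite coef0M !coefD !coefMX !coefC /= !add0r.
case/pP => [pa|pb].
  have : rdvd p%:P (f * (g * 'X + b%:P)).
    apply: mulX; apply: rdvd_addr (_ : rdvd _ (a%:P * (g * 'X + b%:P))) _.
      by apply: rdvd_mull; case: pa => c ->; exists c%:P; rewrite polyCM.
    by rewrite mulrAC -mulrDl addrC.
  by case/IHf => [pf|]; [left; exact: cons|right].
have : rdvd p%:P ((f * 'X + a%:P) * g).
  apply: mulX; apply: rdvd_addr (_ : rdvd _ ((f * 'X + a%:P) * b%:P)) _.
    by apply: rdvd_mulr; case: pb => c ->; exists c%:P; rewrite polyCM.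
  by rewrite -mulrA -mulrDr [b%:P + _]addrC.
by case/IHg => [|pg]; [left|right; exact: cons].
Qed.

(** Absence of prime constants among the divisors stands in for a unit gcd of the coefficients. *)
Definition primitive f := forall p : R, prime_elt p -> ~ rdvd p%:P f.

(** Each prime of [c] divides [f * r] but not [f], hence divides [r], and is cancelled on both
    sides. *)
Lemma primitive_cancel f (c : R) q r : primitive f -> c != 0 ->
  c%:P * q = f * r -> rdvd f q.
Proof.
move=> fprim /factR[w [ps [wU psP ->]]].
elim: ps psP r => [|p ps IH] psP r.
  rewrite big_nil mulr1 => e; exists (w^-1%:P * r).
  by rewrite mulrAC -mulrA -e mulrA -polyCM mulVr // mul1r.
have pP : prime_elt p by apply: psP; rewrite inE eqxx.
have p0 : p%:P != 0 by rewrite polyC_eq0; case: pP.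
rewrite big_cons mulrCA polyCM -mulrA => e.
have [_ _ primep] := prime_polyC pP.
have : rdvd p%:P (f * r) by rewrite -e; apply: rdvd_mull; exact: rdvd_refl.
case/primep => [/(fprim _ pP)//|[r' er]].
apply: (IH _ r') => [p' p'in|]; first by apply: psP; rewrite inE p'in orbT.
by apply: (mulfI p0); rewrite e er mulrA mulrC.
Qed.

(** Each prime of [c] divides one of the two factors and can be divided out of it; a constant does
    not affect sizes. *)
Lemma absorb_scalar f (c : R) a b : c != 0 -> c%:P * f = a * b ->
  exists a' b', [/\ f = a' * b', size a' = size a & size b' = size b].
Proof.
move=> /factR[w [ps [wU psP ->]]].
have szC (p : R) g : p != 0 -> size (g * p%:P) = size g.
  by move=> p0; rewrite mulrC mul_polyC size_scale.
elim: ps psP a b => [|p ps IH] psP a b.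
  rewrite big_nil mulr1 => e; exists (w^-1%:P * a), b; split=> //.
    by rewrite -mulrA -e mulrA -polyCM mulVr // mul1r.
  by rewrite mulrC szC // invr_eq0; apply: contraTneq wU => ->; rewrite unitr0.
have pP : prime_elt p by apply: psP; rewrite inE eqxx.
have pn0 : p != 0 by case: pP.
have p0 : p%:P != 0 by rewrite polyC_eq0.
have {}IH := IH (fun p' p'in => psP p' (mem_behead (s := p :: ps) p'in)).
rewrite big_cons mulrCA polyCM -mulrA => e.
have [_ _ primep] := prime_polyC pP.
have : rdvd p%:P (a * b) by rewrite -e; apply: rdvd_mull; exact: rdvd_refl.
case/primep => [[a' ea]|[b' eb]].
  have [|a2 [b2 [ef sa sb]]] := IH a' b.
    by apply: (mulfI p0); rewrite e ea mulrAC mulrC.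
  by exists a2, b2; rewrite ea szC.
have [|a2 [b2 [ef sa sb]]] := IH a b'.
  by apply: (mulfI p0); rewrite e eb mulrA mulrC.
by exists a2, b2; rewrite eb szC.
Qed.

(** If [f] divides [a * b], take the gcd of [f] and [a] up to scalars. Since [f] has no proper
    splitting, this gcd has the size of [f], and [f] divides [a] up to a scalar, or it is constant,
    and [f] divides [b] up to a scalar. Primitivity removes the scalar. *)
Lemma primitive_prime f : (1 < size f)%N -> primitive f ->
  (forall a b, f = a * b -> (size a <= 1)%N \/ (size b <= 1)%N) -> prime_elt f.
Proof.
move=> sz fprim nosplit.
have f0 : f != 0 by rewrite -size_poly_gt0 ltnW.
have dvd q : Pdiv.Idomain.dvdp f q -> rdvd f q.
  case/Pdiv.Idomain.dvdpP => -[c r] /= c0 e.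
  by apply: (primitive_cancel fprim c0 (r := r)); rewrite mul_polyC e mulrC.
split=> // [|a b [s e]]; first by rewrite poly_unitE gtn_eqF.
have fab : Pdiv.Idomain.dvdp f (a * b) by rewrite e Pdiv.Idomain.dvdp_mull.
have gf := Pdiv.Idomain.dvdp_gcdl f a.
have g0 : Pdiv.Idomain.gcdp f a != 0 by rewrite Pdiv.Idomain.gcdp_eq0 (negbTE f0).
case/Pdiv.Idomain.dvdpP: (gf) => -[c r] /= c0 er.
have [a' [b' [ef sa sb]]] : exists a' b', [/\ f = a' * b', size a' = size r &
    size b' = size (Pdiv.Idomain.gcdp f a)].
  by apply: (absorb_scalar c0); rewrite mul_polyC.
case: (nosplit _ _ ef) => [|]; rewrite ?sa ?sb => le1.
  left; apply: dvd; apply: Pdiv.Idomain.dvdp_trans (Pdiv.Idomain.dvdp_gcdr f a).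
  have : size (Pdiv.Idomain.gcdp f a) == size f.
    have b'0 : b' != 0 by apply: contraNneq f0 => b'0; rewrite ef b'0 mulr0.
    have a'0 : a' != 0 by apply: contraNneq f0 => a'0; rewrite ef a'0 mul0r.
    rewrite -sb [in X in _ == X]ef size_mul // sa.
    have : (0 < size r)%N by rewrite -sa size_poly_gt0.
    by case: (size r) le1 => [|[]].
  by rewrite Pdiv.Idomain.dvdp_size_eqp // => /andP[].
right; apply: dvd; rewrite -(@Pdiv.Idomain.Gauss_dvdpr _ _ a) //.
rewrite Pdiv.Idomain.coprimep_def eqn_leq le1 size_poly_gt0 //.
Qed.

(* Strip off the prime factors of the leading coefficient one by one. *)
Lemma extract_content f : f != 0 ->
  exists g (cs : seq R), [/\ f = g * \prod_(c <- cs) c%:P,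
    forall c, c \in cs -> prime_elt c & primitive g].
Proof.
move=> f0; have := f0; rewrite -lead_coef_eq0 => /factR[w [ps [wU psP e]]].
(* Invariant of the induction: the cofactor ([w], then [b]) collects the part of the leading
   coefficient free of primes dividing [f]. Once [ps] is exhausted it is the whole leading
   coefficient, so no prime constant divides [f]. *)
have : forall r : R, prime_elt r -> rdvd r%:P f -> ~ rdvd r w.
  by move=> r [_ rU _] _ /rdvd_unit/(_ wU); rewrite (negbTE rU).
move: w {wU} e; elim: ps psP f f0 => [|p ps IH] psP f f0 b.
  rewrite big_nil mulr1 => e H; exists f, [::]; rewrite big_nil mulr1; split=> // r rP rf.
  by apply: (H r rP rf); rewrite -e; move/rdvd_polyC: rf; apply.
have pP : prime_elt p by apply: psP; rewrite inE eqxx.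
have pn0 : p != 0 by case: pP.
have {}IH := IH (fun p' p'in => psP p' (mem_behead (s := p :: ps) p'in)).
rewrite big_cons => e H.
have [[g eg]|npf] := EM (rdvd p%:P f).
  have g0 : g != 0 by apply: contraNneq f0 => g0; rewrite eg g0 mul0r.
  have [||g' [cs [eg' csP prim]]] := IH g g0 b.
  - move: e; rewrite eg lead_coefM lead_coefC mulrCA mulrC => /mulfI; exact.
  - by move=> r rP rg; apply: H => //; rewrite eg; exact: rdvd_mull.
  exists g', (p :: cs); rewrite big_cons eg eg'; split=> //.
    by rewrite -mulrA [X in _ * X]mulrC.
  by move=> c; rewrite inE => /orP[/eqP->|/csP].
apply: (IH f f0 (b * p)); first by rewrite e mulrA.
move=> r rP rf; have [_ _ rprime] := rP; case/rprime => [/(H r rP rf)//|rp].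
have [d ed] := prime_rdvd_sym rP pP rp.
by apply: npf; apply: rdvd_trans rf; exists d%:P; rewrite ed polyCM.
Qed.

(** A product of two nonconstant polynomials is settled by induction on the size. Otherwise the
    content splits off, and the primitive part is prime if nonconstant and a unit if constant. *)
Lemma factorial_poly : factorial_ring {poly R}.
Proof.
move=> f; have [n] := ubnP (size f); elim: n f => // n IH f; rewrite ltnS => szf f0.
have [[a [b [ef sa sb]]]|nosplit] :=
    EM (exists a b, [/\ f = a * b, (1 < size a)%N & (1 < size b)%N]).
  have a0 : a != 0 by rewrite -size_poly_gt0 ltnW.
  have b0 : b != 0 by rewrite -size_poly_gt0 ltnW.
  move: szf; rewrite ef size_mul // => szf.
  apply: prime_factoredM; apply: IH => //; apply: leq_trans szf.
    by rewrite -subn1 -addnBA ?(ltnW sb) // -[X in (X < _)%N]addn0 ltn_add2l subn_gt0.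
  by rewrite addnC -subn1 -addnBA ?(ltnW sa) // -[X in (X < _)%N]addn0 ltn_add2l subn_gt0.
have [g [cs [ef csP gprim]]] := extract_content f0.
rewrite ef; apply: prime_factoredM; last first.
  elim: cs csP {ef} => [|c cs IHcs] csP.
    by rewrite big_nil; apply: prime_factored_unit; exact: unitr1.
  rewrite big_cons; apply: prime_factoredM.
    by apply/prime_factored_prime/prime_polyC/csP; rewrite inE eqxx.
  by apply: IHcs => c' c'in; apply: csP; rewrite inE c'in orbT.
have cs0 : \prod_(c <- cs) c%:P != 0 by apply: contraNneq f0 => e; rewrite ef e mulr0.
have g0 : g != 0 by apply: contraNneq f0 => e; rewrite ef e mul0r.
have [sg|/size1_polyC eg] := ltnP 1 (size g).
  apply/prime_factored_prime/primitive_prime => // a b eg.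
  have [|sa] := leqP (size a) 1; first by left.
  have [|sb] := leqP (size b) 1; first by right.
  case: nosplit; exists a, (b * \prod_(c <- cs) c%:P).
  rewrite mulrA -eg; split=> //; rewrite size_mul //; last by rewrite -size_poly_gt0 ltnW.
  rewrite -subn1 -addnBA ?size_poly_gt0 //; exact: leq_trans sb (leq_addr _ _).
have : g`_0 != 0 by rewrite -polyC_eq0 -eg.
case/factR => w [ps [wU psP e]].
case: ps psP e => [|p ps] psP e.
  apply: prime_factored_unit; rewrite eg e big_nil mulr1 poly_unitE size_polyC coefC eqxx wU.
  by rewrite andbT; apply/eqP; case: eqP wU => // ->; rewrite unitr0.
case: (gprim p); first by apply: psP; rewrite inE eqxx.
by rewrite eg e big_cons; exists (w * \prod_(j <- ps) j)%:P; rewrite -polyCM mulrAC -mulrA.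
Qed.

End PolyFactorial.

Lemma factorial_iso (A B : idomainType) (f : {rmorphism A -> B}) (g : {rmorphism B -> A}) :
  cancel f g -> cancel g f -> factorial_ring B -> factorial_ring A.
Proof.
move=> fK gK factB a a0.
have fa0 : f a != 0 by apply: contraNneq a0 => e; rewrite -(fK a) e rmorph0.
have [w [ps [wU psP e]]] := factB _ fa0.
exists (g w), (map g ps); split; first exact: rmorph_unit.
  move=> p /mapP[q /psP[q0 qU qP] ->]; split.
  - by apply: contraNneq q0 => e'; rewrite -(gK q) e' rmorph0.
  - by apply: contra qU => /(rmorph_unit f); rewrite gK.
  move=> x y [z ez]; have : rdvd q (f x * f y).
    by exists (f z); rewrite -rmorphM ez rmorphM gK.
  by case/qP => -[t et]; [left|right]; exists (g t); rewrite -rmorphM -et fK.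
by rewrite -(fK a) e rmorphM rmorph_prod big_map.
Qed.

(** * Several variables, adjoining the last one as X *)

Section MpolyFactorial.
Variable K : fieldType.

Definition unmuni n (p : {poly {mpoly K[n]}}) : {mpoly K[n.+1]} :=
  (map_poly (@mwiden n K) p).['X_ord_max].

Lemma unmuni_additive n : additive (@unmuni n).
Proof. by move=> p q; rewrite /unmuni rmorphB hornerD hornerN. Qed.

Lemma unmuni_multiplicative n : multiplicative (@unmuni n).
Proof. by split=> [p q|]; rewrite /unmuni ?rmorphM ?rmorph1 ?hornerM ?hornerC. Qed.

HB.instance Definition _ n :=
  GRing.isAdditive.Build {poly {mpoly K[n]}} {mpoly K[n.+1]} (@unmuni n)
    (@unmuni_additive n).
HB.instance Definition _ n :=
  GRing.isMultiplicative.Build {poly {mpoly K[n]}} {mpoly K[n.+1]} (@unmuni n)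
    (@unmuni_multiplicative n).

Lemma muniK n : cancel (@muni n K) (@unmuni n).
Proof.
move=> p; rewrite muniE [RHS]mpolyE rmorph_sum /=; apply: eq_bigr => m _.
rewrite /unmuni map_polyZ /= map_polyXn hornerZ hornerXn mwidenZ mwidenX -scalerAl.
congr (_ *: _); rewrite mpolyXn -mpolyXD; congr mpolyX; apply/mnmP => i.
rewrite mnmDE mulmnE mnm1E; case: (unliftP ord_max i) => [j ->|->].
  have -> : lift ord_max j = widen_ord (leqnSn n) j.
    by apply/val_inj; rewrite /= /bump leqNgt ltn_ord.
  rewrite mnmwiden_widen mnmE -val_eqE /= gtn_eqF ?ltn_ord //= mul0n addn0 //.
by rewrite mnmwiden_ordmax eqxx mul1n.
Qed.

Lemma unmuniK n : cancel (@unmuni n) (@muni n K).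
Proof.
move=> q; rewrite /unmuni horner_coef rmorph_sum /= -[RHS]coefK poly_def.
rewrite size_map_inj_poly ?raddf0 //; last exact: inj_mwiden.
apply: eq_bigr => i _; rewrite coef_map /= rmorphM rmorphXn /=.
have -> : muni ('X_ord_max : {mpoly K[n.+1]}) = 'X.
  rewrite muniE msuppX big_seq1 mcoeffX eqxx scale1r mnm1E eqxx expr1.
  rewrite (_ : [multinom _ | j < n] = 0%MM) ?mpolyX0 ?scale1r //.
  by apply/mnmP => j; rewrite !mnmE -val_eqE /= gtn_eqF ?ltn_ord.
rewrite -mul_polyC; congr (_ * _).
rewrite (mpolyE q`_i) [mwiden _]raddf_sum [LHS]raddf_sum [RHS]raddf_sum /=.
apply: eq_bigr => m _.
rewrite mwidenZ mwidenX muniZ muniE msuppX big_seq1 mcoeffX eqxx scale1r.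
rewrite mnmwiden_ordmax expr0 -mul_polyC -mul_mpolyC polyCM; congr (_ * _).
rewrite -mul_polyC mulr1; congr (mpolyX _ _)%:P; apply/mnmP => j.
by rewrite mnmE mnmwiden_widen.
Qed.

Lemma factorial_mpoly n : factorial_ring {mpoly K[n]}.
Proof.
elim: n => [|n IH]; last first.
  exact: factorial_iso (@muniK n) (@unmuniK n) (factorial_poly IH).
move=> p p0; apply: prime_factored_unit; rewrite (nvar0_mpolyC p).
apply: rmorph_unit; rewrite unitfE; apply: contraNneq p0 => e.
by rewrite (nvar0_mpolyC p) e.
Qed.

End MpolyFactorial.

(** * Weighted homogeneity and graded pieces *)

(** After all powers of X are removed from [f] and [g], the product of the cofactors has nonzero
    constant term and is a monomial. It is therefore a nonzero constant, and over a domain both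
    cofactors are constants. *)
Lemma poly_monomial_factor (A : idomainType) (f g : {poly A}) (c : A) d :
  c != 0 -> f * g = c%:P * 'X^d -> exists k a, f = a%:P * 'X^k.
Proof.
move=> c0 e.
have fg0 : f * g != 0.
  by rewrite e mulf_neq0 ?polyC_eq0 // -size_poly_gt0 size_polyXn.
have /andP[f0 g0] : (f != 0) && (g != 0) by rewrite -negb_or -mulf_eq0.
have [k [f' f'0 ef]] := multiplicity_XsubC f 0.
have [l [g' g'0 eg]] := multiplicity_XsubC g 0.
rewrite f0 /= in f'0; rewrite g0 /= in g'0.
have f'g'0 : (f' * g').[0] != 0 by rewrite hornerM mulf_neq0.
move: ef eg e; rewrite subr0 => ef eg; rewrite ef eg mulrACA -exprD.
exists k, f'`_0; congr (_ * _); apply: size1_polyC.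
have [kl|kl] := ltnP d (k + l).
  have : (f' * g' * 'X^(k + l))`_d = (c%:P * 'X^d)`_d by rewrite e.
  by rewrite coefMXn kl coefCM coefXn eqxx mulr1 => c0'; rewrite -c0' eqxx in c0.
have Xn0 : ('X^(k + l) : {poly A}) != 0 by rewrite -size_poly_gt0 size_polyXn.
move: e; rewrite -{1}(subnK kl) [in RHS]exprD [in RHS]mulrA => /(mulIf Xn0) e.
have dkl : (d - (k + l))%N = 0%N.
  apply/eqP; apply: contraNT f'g'0 => /negPf nz.
  by rewrite e hornerM hornerXn expr0n nz mulr0.
move: e; rewrite dkl expr0 mulr1 => e.
have f'n0 : f' != 0 by apply: contraNneq f0 => z; rewrite ef z mul0r.
have g'n0 : g' != 0 by apply: contraNneq g0 => z; rewrite eg z mul0r.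
have : size (f' * g') = 1%N by rewrite e size_polyC c0.
rewrite size_mul //; have := f'n0; have := g'n0; rewrite -!size_poly_gt0.
by move: (size f') (size g') => a b; clear; lia.
Qed.

Section Homog.
Variables (K : fieldType) (n : nat) (u : 'I_n -> int).
Local Notation S := {mpoly K[n]}.
Implicit Types p q : S.

Lemma wdegD m m' : wdeg u (m + m')%MM = wdeg u m + wdeg u m'.
Proof. by rewrite -big_split; apply: eq_bigr => i _; rewrite mnmDE PoszD mulrDr. Qed.

Lemma wdeg1 i : wdeg u U_(i)%MM = u i.
Proof.
rewrite /wdeg (bigD1 i) //= mnm1E eqxx mulr1 big1 ?addr0 // => k ki.
by rewrite mnm1E eq_sym (negbTE ki) mulr0.
Qed.

Lemma whomogP d p : whomog u d p <-> forall m, p@_m != 0 -> wdeg u m = d.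
Proof. by split=> H m; [rewrite -mcoeff_msupp|rewrite mcoeff_msupp]; exact: H. Qed.

Lemma whomog0 d : whomog u d (0 : S).
Proof. by apply/whomogP => m; rewrite mcoeff0 eqxx. Qed.

Lemma whomogX m : whomog u (wdeg u m) ('X_[m] : S).
Proof.
by apply/whomogP => m'; rewrite mcoeffX; case: (m =P m') => [->|]; rewrite ?eqxx.
Qed.

Lemma whomogC (c : K) : whomog u 0 (c%:MP : S).
Proof.
apply/whomogP => m; rewrite mcoeffC; case: (m =P 0%MM) => [-> _|_].
  by rewrite /wdeg big1 // => i _; rewrite mnm0E mulr0.
by rewrite mulr0 eqxx.
Qed.

Lemma whomog_lin d (a : K) p q : whomog u d p -> whomog u d q -> whomog u d (a *: p + q).
Proof.
move=> /whomogP hp /whomogP hq; apply/whomogP => m; rewrite mcoeffD mcoeffZ => ne.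
have [pm|/hp //] := eqVneq (p@_m) 0.
by apply: hq; move: ne; rewrite pm mulr0 add0r.
Qed.

Lemma whomogD d p q : whomog u d p -> whomog u d q -> whomog u d (p + q).
Proof. by move=> hp hq; rewrite -[p]scale1r; exact: whomog_lin. Qed.

Lemma whomog_sum d (I : Type) (l : seq I) (P : pred I) (F : I -> S) :
  (forall i, P i -> whomog u d (F i)) -> whomog u d (\sum_(i <- l | P i) F i).
Proof. by move=> H; elim/big_rec: _ => [|i x /H]; [exact: whomog0|exact: whomogD]. Qed.

Lemma whomogM d e p q : whomog u d p -> whomog u e q -> whomog u (d + e) (p * q).
Proof.
move=> hp hq m /msuppM_le /allpairsP[[m1 m2] /= [/hp e1 /hq e2 ->]].
by rewrite wdegD e1 e2.
Qed.

Lemma whomog_exp d p e : whomog u d p -> whomog u (e%:Z * d) (p ^+ e).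
Proof.
move=> hp; elim: e => [|e IH]; first by rewrite mul0r expr0 -mpolyC1; exact: whomogC.
by rewrite exprS intS mulrDl mul1r; exact: whomogM.
Qed.

Lemma whomog_prod (I : Type) (l : seq I) (P : pred I) (F : I -> S) (D : I -> int) :
  (forall i, whomog u (D i) (F i)) ->
  whomog u (\sum_(i <- l | P i) D i) (\prod_(i <- l | P i) F i).
Proof.
move=> H; elim/big_rec2: _ => [|i p d _ hp]; last exact: whomogM.
by rewrite -mpolyC1; exact: whomogC.
Qed.

Lemma whomog_deriv d p i : whomog u d p -> whomog u (d - u i) p^`M(i).
Proof.
move=> /whomogP hp; apply/whomogP => m; rewrite mcoeff_deriv => ne.
rewrite -(hp (m + U_(i))%MM) ?wdegD ?wdeg1 ?addrK //.
by apply: contraNneq ne => ->; rewrite mul0rn.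
Qed.

Lemma whomog_uniq d d' p : p != 0 -> whomog u d p -> whomog u d' p -> d = d'.
Proof. by move=> /mlead_supp sp /(_ _ sp) <- /(_ _ sp) <-. Qed.

Hypothesis u0 : forall i, 0 < u i.

Lemma wdeg_ge0 m : 0 <= wdeg u m.
Proof. by apply: sumr_ge0 => i _; have := u0 i; nia. Qed.

(* The substitution x_i := x_i t^{u_i}; weighted homogeneity of [p] means that
   its image is a monomial in t. *)
Definition wlift p : {poly S} :=
  mmap (polyC \o @mpolyC n K) (fun i => ('X_i : S)%:P * 'X^(absz (u i))) p.

Lemma wliftM p q : wlift (p * q) = wlift p * wlift q.
Proof. by rewrite /wlift rmorphM. Qed.

Lemma wliftE p : wlift p =
  \sum_(m <- msupp p) (p@_m *: 'X_[m])%:P * 'X^(absz (wdeg u m)).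
Proof.
apply: eq_bigr => m _; rewrite /= /mmap1.
under eq_bigr => i _ do rewrite exprMn -exprM.
rewrite big_split /= mulrA; congr (_ * _); last first.
  rewrite -expr_sum; congr ('X^_).
  apply/eqP; rewrite -eqz_nat gez0_abs ?wdeg_ge0 // /wdeg -natz natr_sum.
  by apply/eqP/eq_bigr => i _; rewrite natz PoszM gtz0_abs.
rewrite -mul_mpolyC polyCM; congr (_ * _).
by rewrite mpolyXE_id rmorph_prod /=; apply: eq_bigr => i _; rewrite rmorphXn.
Qed.

Lemma wlift_coef p m : (wlift p)`_(absz (wdeg u m)) @_ m = p@_m.
Proof.
rewrite wliftE coef_sum raddf_sum /= [in RHS](mpolyE p) [RHS]raddf_sum /=; apply: eq_bigr => m' _.
rewrite coefCM coefXn mcoeffZ mcoeffX; case: (m' =P m) => [->|ne].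
  by rewrite eqxx mulr1 mcoeffZ mcoeffX eqxx.
case: eqP => _; rewrite ?mulr0 ?mulr1 ?mcoeff0 //.
by rewrite mcoeffZ mcoeffX; case: eqP ne => // _ _; rewrite mulr0.
Qed.

Lemma whomog_wlift d p : whomog u d p -> wlift p = p%:P * 'X^(absz d).
Proof.
move=> hp; rewrite wliftE [in RHS](mpolyE p) raddf_sum mulr_suml /=.
by rewrite big_seq [RHS]big_seq; apply: eq_bigr => m /hp ->.
Qed.

(** The lift of the product is a monomial in t over the domain [S], so the lift of each factor is a
    monomial too. *)
Lemma whomog_factor d p q : p * q != 0 -> whomog u d (p * q) -> exists e, whomog u e p.
Proof.
move=> pq0 /whomog_wlift; rewrite wliftM => /(poly_monomial_factor pq0)[k [a e]].
exists k%:Z; apply/whomogP => m; rewrite -wlift_coef e coefCM coefXn.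
case: (absz (wdeg u m) =P k) => [<- _|_]; last by rewrite mulr0 mcoeff0 eqxx.
by rewrite gez0_abs ?wdeg_ge0.
Qed.

Lemma whomog_quot d e p q : p != 0 -> whomog u e p -> whomog u d (p * q) ->
  whomog u (d - e) q.
Proof.
move=> p0 hp hpq; have [->|q0] := eqVneq q 0; first exact: whomog0.
have pq0 : p * q != 0 by rewrite mulf_neq0.
have [||e' hq] := @whomog_factor d q p; rewrite ?[q * p]mulrC //.
by rewrite (whomog_uniq pq0 hpq (whomogM hp hq)) addrC addKr.
Qed.

End Homog.

(** * Hilbert functions of graded submodules of free modules *)

Section GradedPieces.
Variables (K : fieldType) (n : nat) (u : 'I_n -> int).
Hypothesis u0 : forall i, 0 < u i.
Local Notation S := {mpoly K[n]}.

Definition weights : seq int := [seq u i | i <- enum 'I_n].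

Lemma weights_gt0 w : w \in weights -> 0 < w.
Proof. by case/mapP => i _ ->. Qed.

Lemma size_weights : size weights = n.
Proof. by rewrite size_map size_enum_ord. Qed.

Definition mnm_of (s : seq nat) : 'X_{1..n} := [multinom nth 0%N s i | i < n].
Definition seq_of (m : 'X_{1..n}) : seq nat := [seq m i | i <- enum 'I_n].

Lemma size_seq_of m : size (seq_of m) = n.
Proof. by rewrite size_map size_enum_ord. Qed.

Lemma seq_ofK : cancel seq_of mnm_of.
Proof.
move=> m; apply/mnmP => i; rewrite mnmE (nth_map i) ?size_enum_ord //.
by rewrite nth_ord_enum.
Qed.

Lemma mnm_ofK s : size s = n -> seq_of (mnm_of s) = s.
Proof.
move=> sz; apply: (@eq_from_nth _ 0%N); rewrite size_seq_of ?sz // => i lti.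
by rewrite (nth_map (Ordinal lti)) ?size_enum_ord // mnmE nth_enum_ord.
Qed.

Lemma swt_seq_of m : swt weights (seq_of m) = wdeg u m.
Proof.
rewrite /wdeg -big_enum /weights /seq_of.
by elim: (enum _) => [|i l IH]; rewrite ?big_nil // big_cons /= IH.
Qed.

Lemma swt_mnm_of s : size s = n -> swt weights s = wdeg u (mnm_of s).
Proof. by move=> sz; rewrite -swt_seq_of mnm_ofK. Qed.

Lemma mem_mons_mnm m j : (seq_of m \in mons weights j) = (wdeg u m == j).
Proof.
rewrite mem_mons; last exact: weights_gt0.
by rewrite size_seq_of size_weights eqxx swt_seq_of.
Qed.

Variable r : nat.
Local Notation V := {ffun 'I_r -> S}.
Local Notation T := ('I_r *l 'X_{1..n})%type.

(** The degree [j] part of a free module whose i-th basis vector has degree [v i]. *)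
Definition piece (v : 'I_r -> int) (j : int) (x : V) :=
  forall i, whomog u (j - v i) (x i).

Lemma subspace_piece v j : subspace (piece v j).
Proof.
split=> [i|a x y hx hy i]; rewrite !ffunE; first exact: whomog0.
exact: whomog_lin.
Qed.

Definition coefT (t : T) (x : V) : K := (x t.1)@_t.2.

Lemma coefT_lin t a x y : coefT t (a *: x + y) = a * coefT t x + coefT t y.
Proof. by rewrite /coefT !ffunE mcoeffD mcoeffZ. Qed.

Definition positions (v : 'I_r -> int) (j : int) : seq T :=
  flatten [seq [seq ((i, mnm_of s) : T) | s <- mons weights (j - v i)] | i <- enum 'I_r].

Lemma mem_positions v j (t : T) :
  (t \in positions v j) = (wdeg u t.2 == j - v t.1).
Proof.
case: t => i m /=; rewrite -mem_mons_mnm; apply/flatten_mapP/idP.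
  move=> [i' _ /mapP[s sin [-> ->]]]; rewrite mnm_ofK //.
  by move: sin; rewrite mem_mons ?size_weights => [/andP[/eqP]//|]; exact: weights_gt0.
move=> mi; exists i; first by rewrite mem_enum.
by rewrite -[in X in X \in _](seq_ofK m); apply: map_f.
Qed.

Lemma uniq_positions v j : uniq (positions v j).
Proof.
rewrite /positions; elim: (enum _) (enum_uniq 'I_r) => //= i l IH /andP[il /IH].
rewrite cat_uniq => ->; rewrite map_inj_in_uniq ?uniq_mons ?andbT /=.
  apply/hasPn => t /flatten_mapP[i' i'l /mapP[s _ ->]].
  by apply/mapP => -[s' _ [e _]]; move: il; rewrite -e i'l.
move=> s s'; rewrite !mem_mons ?size_weights; try exact: weights_gt0.
move=> /andP[/eqP sz _] /andP[/eqP sz' _] /(congr1 snd) /= e.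
by rewrite -(mnm_ofK sz) e mnm_ofK.
Qed.

(** The monomial x^s e_i lives in degree [swt weights s + v i] only, so one exponent set per
    component records the leading monomials of all degrees at once. *)
Definition lead_set (v : 'I_r -> int) (P : int -> V -> Prop) (i : 'I_r) : pred (seq nat) :=
  fun s => asbool (leads <%O coefT (P (swt weights s + v i)) (i, mnm_of s)).

Lemma hasdim_lead_set v P j : subspace (P j) -> (forall x, P j x -> piece v j x) ->
  hasdim (P j) (\sum_(i < r) count (lead_set v P i) (mons weights (j - v i))).
Proof.
move=> sP Pv.
pose s := sort <=%O (positions v j).
have sE : s =i positions v j by move=> t; rewrite mem_sort.
have := @hasdim_leads K V T <%O coefT coefT_lin _ (P j) sP s.
have -> : count (fun t => asbool (leads <%O coefT (P j) t)) s =
    (\sum_(i < r) count (lead_set v P i) (mons weights (j - v i)))%N.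
  rewrite (permP (permEl (perm_sort _ _))) count_flatten -map_comp sumnE big_map.
  rewrite big_enum /=; apply: eq_bigr => i _.
  rewrite count_map; apply: eq_in_count => l; rewrite mem_mons; last exact: weights_gt0.
  by move=> /andP[_ /eqP e]; rewrite /= /lead_set e subrK.
apply.
- by move=> t t' lt; rewrite -leNgt ltW.
- rewrite -sorted_pairwise; last exact: lt_trans.
  by rewrite sort_lt_sorted uniq_positions.
- move=> x t /Pv px; rewrite sE mem_positions => /eqP ne.
  apply/eqP/negPn/negP => c; apply: ne.
  by apply: (px t.1); rewrite mcoeff_msupp.
- move=> x /Pv px xs; apply/ffunP => i; rewrite ffunE; apply/mpolyP => m.
  rewrite mcoeff0; have [c|c] := eqVneq (wdeg u m) (j - v i).
    by apply: (xs (i, m)); rewrite sE mem_positions c.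
  apply/eqP/negPn/negP => c'; case/eqP: c.
  by apply: (px i); rewrite mcoeff_msupp.
Qed.

Lemma mcoeffMX_notle (p : S) (m k : 'X_{1..n}) : ~~ (m <= k)%MM -> (p * 'X_[m])@_k = 0.
Proof.
move=> mk; apply/eqP; rewrite mcoeff_eq0 (perm_mem (msuppMX _ _)).
by apply/mapP => -[m' _ e]; rewrite e lem_addr in mk.
Qed.

(** The monomial order is invariant under translation, so multiplication by x^d moves the least term
    of an element from [m] to [d + m]. *)
Lemma upset_lead_set v (P : int -> V -> Prop) i :
  (forall m j (x : V), P j x -> P (j + wdeg u m) [ffun i => x i * 'X_[m]]) ->
  upset n (lead_set v P i).
Proof.
move=> PX s s' sz sz' le /asboolP[x Px [xl x0]]; apply/asboolP.
pose m := mnm_of s; pose m' := mnm_of s'.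
have mm' : (m <= m')%MM.
  apply/mnm_lepP => k; rewrite !mnmE.
  move: le; rewrite all2E sz sz' eqxx /= => /allP/(_ (nth 0 s k, nth 0 s' k)%N); apply.
  by rewrite -nth_zip ?sz ?sz' // mem_nth // size_zip sz sz' minnn.
pose d := (m' - m)%MM; have em' : m' = (d + m)%MM by rewrite submK.
exists [ffun i => x i * 'X_[d]].
  have := PX d _ _ Px.
  rewrite (swt_mnm_of sz) (swt_mnm_of sz') -/m -/m' em' wdegD.
  by congr (P _ _); ring.
rewrite /coefT /= ffunE -/m' em' mcoeffMX; split; first exact: xl.
move=> [i' k]; rewrite ltxi_pair /= ffunE => /andP[le1 /implyP lt2].
have [/submK ek|nle] := boolP (d <= k)%MM; last exact: mcoeffMX_notle.
move: lt2; rewrite -ek [(k - d + d)%MM]addmC mcoeffMX ltmc_add2r => lt2.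
by apply: (x0 (i', _)); rewrite ltxi_pair /= le1 /=; apply/implyP.
Qed.

Definition hfun (v : 'I_r -> int) (L : 'I_r -> pred (seq nat)) (j : int) : int :=
  \sum_(i < r) cnt weights (L i) (j - v i).

Lemma good_hfun v L : (forall i, upset n (L i)) -> good weights (hfun v L).
Proof.
move=> Lup; apply: good_sum => i; apply: good_shift; apply: good_upset.
  exact: weights_gt0.
by rewrite size_weights.
Qed.

Lemma hfun_lt v L (a : nat) j : (\sum_i absz (v i) <= a)%N -> j < - a%:Z -> hfun v L j = 0.
Proof.
move=> va ja; rewrite /hfun big1 // => i _; apply: cnt_neg; first exact: weights_gt0.
have : (absz (v i) <= a)%N by apply: leq_trans va; rewrite (bigD1 i) //= leq_addr.
lia.
Qed.

Definition hfree v := hfun v (fun=> predT).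

(** Here K is sum_i t^{v_i}. *)
Lemma laurent_hfree v : laurent (deltas weights (hfree v)) r%:Z (\sum_i v i).
Proof.
have -> : r%:Z = \sum_(i < r) 1 by rewrite sumr_const card_ord natz.
apply: laurent_ext (laurent_sum _ (fun i => laurent_delta (v i))) => j.
rewrite deltas_sum; apply: eq_bigr => i _.
by rewrite deltas_shift deltas_cnt ?subr_eq0 //; exact: weights_gt0.
Qed.

Lemma hasdim_piece v j : exists2 d, hasdim (piece v j) d & d%:Z = hfree v j.
Proof.
exists (\sum_(i < r) count (lead_set v (piece v) i) (mons weights (j - v i)))%N.
  by apply: hasdim_lead_set => //; exact: subspace_piece.
rewrite -natz natr_sum; apply: eq_bigr => i _; rewrite natz; congr Posz.
apply: eq_in_count => s; rewrite mem_mons; last exact: weights_gt0.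
rewrite size_weights => /andP[/eqP sz _]; apply/asboolP.
exists [ffun i' => if i' == i then 'X_[mnm_of s] else 0].
  move=> i'; rewrite ffunE; case: eqP => [->|_]; last exact: whomog0.
  by rewrite addrK (swt_mnm_of sz); exact: whomogX.
rewrite /coefT /= ffunE eqxx mcoeffX eqxx; split; first by apply/eqP; exact: oner_neq0.
move=> [i' m]; rewrite ltxi_pair /= ffunE => /andP[le1 /implyP lt2].
case: (i' =P i) => [e|_]; last by rewrite mcoeff0.
rewrite mcoeffX; case: eqP => // em.
by move: lt2; rewrite e lexx -em ltxx => /(_ isT).
Qed.

(** Multiplication by the [F i] identifies the free module with shifts [v i + D i] with the
    submodule of multiples; homogeneity of quotients gives surjectivity. *)
Lemma hasdim_divisible_piece v (F : 'I_r -> S) (D : 'I_r -> int) j :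
  (forall i, F i != 0) -> (forall i, whomog u (D i) (F i)) ->
  exists2 d, hasdim (fun x => piece v j x /\ forall i, mdvd (F i) (x i)) d
    & d%:Z = hfree (fun i => v i + D i) j.
Proof.
move=> F0 FD; have [d hd ed] := hasdim_piece (fun i => v i + D i) j.
exists d => //; pose f (x : V) : V := [ffun i => F i * x i].
apply: (hasdim_image (f := f)) hd.
- by move=> a x y; apply/ffunP => i; rewrite !ffunE mulrDr scalerAr.
- move=> x /ffunP fx; apply/ffunP => i; have := fx i; rewrite !ffunE => /eqP.
  by rewrite mulf_eq0 (negbTE (F0 i)) => /eqP.
- move=> x px; split=> i; rewrite ffunE; last by exists (x i); rewrite mulrC.
  have -> : j - v i = D i + (j - (v i + D i)) by ring.
  exact: whomogM.
- move=> y [py /choice[q hq]]; exists [ffun i => q i]; last first.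
    by apply/ffunP => i; rewrite !ffunE hq mulrC.
  move=> i; rewrite ffunE.
  have -> : j - (v i + D i) = j - v i - D i by ring.
  by apply: (whomog_quot u0 (F0 i) (FD i)); rewrite mulrC -hq.
Qed.

End GradedPieces.

(** * Logarithmic derivations *)

Section Primes.
Variable R : idomainType.
Implicit Types p a b : R.

Lemma prime_rdvd_prod (I : Type) (l : seq I) (P : pred I) (F : I -> R) p : prime_elt p ->
  rdvd p (\prod_(i <- l | P i) F i) -> exists2 i, P i & rdvd p (F i).
Proof.
move=> [p0 pU pP]; elim/big_rec: _ => [/rdvd_unit/(_ (unitr1 R)) H|i x Pi IH].
  by rewrite H in pU.
by case/pP => [|/IH//]; exists i.
Qed.

Lemma prime_rdvd_exp p a e : prime_elt p -> rdvd p (a ^+ e) -> rdvd p a.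
Proof.
move=> [p0 pU pP]; elim: e => [|e IH]; last by rewrite exprS => /pP[//|/IH].
by rewrite expr0 => /rdvd_unit/(_ (unitr1 R)) H; rewrite H in pU.
Qed.

Lemma prime_rdvd_unitl p a w : w \is a GRing.unit -> rdvd p (w * a) -> rdvd p a.
Proof. by move=> wU [c e]; exists (w^-1 * c); rewrite -mulrA -e mulKr. Qed.

Lemma prime_exp_cancel p a b e : prime_elt p -> ~ rdvd p b ->
  rdvd (p ^+ e) (a * b) -> rdvd (p ^+ e) a.
Proof.
move=> pP npb; have [p0 _ primep] := pP.
elim: e a => [|e IH] a; first by move=> _; exists a; rewrite expr0 mulr1.
case=> c ec; have : rdvd p (a * b).
  by rewrite ec exprS; apply: rdvd_mulr; apply: rdvd_mull; exact: rdvd_refl.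
case/primep => [[a' ea]|//].
rewrite ea exprSr; apply: rdvd_mul2; last exact: rdvd_refl.
apply: IH; exists c; apply: (mulIf p0).
by rewrite mulrAC -ea ec exprSr mulrA.
Qed.

Lemma prime_exp_le p b e e' : prime_elt p -> ~ rdvd p b ->
  rdvd (p ^+ e') (p ^+ e * b) -> (e' <= e)%N.
Proof.
move=> pP npb /(prime_exp_cancel pP npb) [c ec]; rewrite leqNgt; apply/negP => lt.
have [p0 pU _] := pP.
move: ec; rewrite -(subnKC lt) exprD exprS mulrA mulrA mulrC.
have pe0 : p ^+ e != 0 by rewrite expf_neq0.
rewrite -{1}[p ^+ e]mulr1 -mulrA [in RHS]mulrA [in RHS]mulrC.
move=> e1; case/negP: pU; apply: (rdvd_unit (b := 1)); last exact: unitr1.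
exists (c * p ^+ (e' - e.+1)).
apply: (mulfI pe0); rewrite e1; ring.
Qed.

(** A prime associated with an earlier one raises its exponent, and the connecting unit moves into
    [w]; any other prime opens a new index. *)
Lemma group_primes (ps : seq R) : (forall p, p \in ps -> prime_elt p) ->
  exists r (w : R) (fs : 'I_r -> R) (es : 'I_r -> nat),
  [/\ w \is a GRing.unit, forall i, prime_elt (fs i), forall i, (0 < es i)%N,
   forall i j, i != j -> ~ exists s, s \is a GRing.unit /\ fs i = s * fs j &
   \prod_(p <- ps) p = w * \prod_i fs i ^+ es i].
Proof.
elim: ps => [|p ps IH] psP.
  exists 0%N, 1, (fun=> 1), (fun=> 1%N); split; try by case.
    exact: unitr1.
  by rewrite big_nil big_ord0 mulr1.
have pP : prime_elt p by apply: psP; rewrite inE eqxx.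
have [|r [w [fs [es [wU fP e0 nas epr]]]]] := IH.
  by move=> q qps; apply: psP; rewrite inE qps orbT.
rewrite big_cons epr.
have [[i [s [sU es']]]|new] := EM (exists i s, s \is a GRing.unit /\ p = s * fs i).
  exists r, (s * w), fs, (fun j => es j + (j == i))%N; split=> //.
  - by rewrite unitrM sU.
  - by move=> j; rewrite addn_gt0 e0.
  - rewrite es' mulrACA; congr (_ * _); rewrite (bigD1 i) //= [RHS](bigD1 i) //=.
    rewrite eqxx addn1 exprS mulrA; congr (_ * _).
    by apply: eq_bigr => j /negbTE ->; rewrite addn0.
pose fs' (i : 'I_r.+1) := if unlift ord0 i is Some j then fs j else p.
pose es' (i : 'I_r.+1) := if unlift ord0 i is Some j then es j else 1%N.
exists r.+1, w, fs', es'; split=> //.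
- by move=> i; rewrite /fs'; case: unliftP.
- by move=> i; rewrite /es'; case: unliftP.
- move=> i j; rewrite /fs'.
  case: unliftP => [i' ->|->]; case: unliftP => [j' ->|->] ij [s [sU e]].
  + by apply: (nas i' j'); [apply: contraNneq ij => ->|exists s].
  + by apply: new; exists i', s^-1; rewrite unitrV sU e mulKr.
  + by apply: new; exists j', s.
  + by rewrite eqxx in ij.
- rewrite big_ord_recl {1}/fs' {1}/es' unlift_none expr1 mulrCA; congr (_ * (_ * _)).
  by apply: eq_bigr => i _; rewrite /fs' /es' liftK.
Qed.

End Primes.

(** * [Dlog] from a single factorization *)

Section Derivations.
Variables (K : fieldType) (n : nat).
Local Notation S := {mpoly K[n]}.
Implicit Types f g : S.

Lemma mpoly_unitP (w : S) : w \is a GRing.unit -> exists2 c, c != 0 & w = c%:MP.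
Proof.
rewrite unfold_in /= => /andP[/eqP ew cU]; exists w@_0%MM => //.
by rewrite -unitfE.
Qed.

Lemma prime_mirreducible f : prime_elt f -> mirreducible f.
Proof.
move=> [f0 fU fP]; split=> // a b ef.
have [|[s es]|[s es]] := fP a b; first by rewrite -ef; exact: rdvd_refl.
  right; apply: (rdvd_unit (b := 1)); last exact: unitr1.
  by exists s; apply: (mulIf f0); rewrite mul1r {1}ef es; ring.
left; apply: (rdvd_unit (b := 1)); last exact: unitr1.
by exists s; apply: (mulIf f0); rewrite mul1r {1}ef es; ring.
Qed.

(** Split off one prime [p] of a prime factorization: by irreducibility the cofactor is a unit, so
    [f] is associated with [p]. *)
Lemma mirreducible_prime f : mirreducible f -> prime_elt f.
Proof.
move=> [f0 fU firr]; have [w [[|p ps] [wU psP e]]] := factorial_mpoly f0.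
  by move: fU; rewrite e big_nil mulr1 wU.
have pP : prime_elt p by apply: psP; rewrite inE eqxx.
have ef : f = p * (w * \prod_(q <- ps) q) by rewrite e big_cons mulrCA.
have [pU pN pr] := pP.
case: (firr _ _ ef) => [|sU]; first by rewrite (negbTE pN).
split=> // a b fab.
have fp : rdvd p f by rewrite ef; apply: rdvd_mull; exact: rdvd_refl.
have pf : rdvd f p.
  by rewrite ef; exists (w * \prod_(q <- ps) q)^-1; rewrite mulrC mulrK.
by case: (pr a b (rdvd_trans fp fab)) => H; [left|right]; exact: rdvd_trans pf H.
Qed.

Lemma der_applyZ (d : Der K n) (c : K) g :
  der_apply d (c%:MP * g) = c%:MP * der_apply d g.
Proof. by rewrite /der_apply mulr_sumr; apply: eq_bigr => i _; rewrite mderiv_mulC mulrCA. Qed.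

Lemma Dge_le (d : Der K n) f e e' : (e' <= e)%N -> Dge f e d -> Dge f e' d.
Proof. by move=> le; apply: rdvd_trans; exact: rdvd_exp_le. Qed.

Lemma Dge_assoc (d : Der K n) f g e : massociated g f -> Dge f e d -> Dge g e d.
Proof.
move=> [w [wU ->]] fd; have [c c0 ew] := mpoly_unitP wU; rewrite /Dge ew der_applyZ.
apply: rdvd_mulr; rewrite exprMn -ew; case: fd => s ->.
exists (s * w ^- e); rewrite mulrA -[_ / _ * _]mulrA mulVr ?mulr1 //.
exact: unitrX.
Qed.

Section Factorization.
Variables (Q : S) (r : nat) (c : K) (fs : 'I_r -> S) (es : 'I_r -> nat).
Hypotheses (c0 : c != 0) (fP : forall i, prime_elt (fs i)) (e0 : forall i, (0 < es i)%N).
Hypothesis fN : forall i j, i != j -> ~ massociated (fs i) (fs j).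
Hypothesis eQ : Q = c%:MP * \prod_(i < r) fs i ^+ es i.

Definition factor_compl i := \prod_(j < r | j != i) fs j ^+ es j.

Lemma prime_massociated f g : prime_elt f -> prime_elt g -> rdvd f g -> massociated f g.
Proof.
move=> fp gp fg; have [s es'] := prime_rdvd_sym fp gp fg; exists s; split=> //.
case: fg => t et; have [g0 _ _] := gp.
have : t * s = 1 by apply: (mulIf g0); rewrite mul1r -mulrA -es' -et.
by move=> ts; apply/unitrP; exists t; split=> //; rewrite mulrC.
Qed.

Lemma factor_compl_ndvd i : ~ rdvd (fs i) (factor_compl i).
Proof.
case/(prime_rdvd_prod (fP i)) => j ji /(prime_rdvd_exp (fP i)) fij.
by apply: (fN (i := i) (j := j)); [rewrite eq_sym|exact: prime_massociated].
Qed.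

Lemma factorization_compl i : Q = fs i ^+ es i * (c%:MP * factor_compl i).
Proof. by rewrite eQ (bigD1 i) //= mulrCA. Qed.

Lemma mpolyC_unit (a : K) : a != 0 -> (a%:MP : S) \is a GRing.unit.
Proof. by move=> a0; apply: rmorph_unit; rewrite unitfE. Qed.

Lemma factor_compl_ndvdC i : ~ rdvd (fs i) (c%:MP * factor_compl i).
Proof. by move/(prime_rdvd_unitl (mpolyC_unit c0)); exact: factor_compl_ndvd. Qed.

(** [Dlog] ranges over all factorizations. In any of them each irreducible is associated with some
    [fs i], and its power divides [Q], so its exponent is at most [es i]. *)
Lemma DlogP (d : Der K n) : Dlog Q d <-> forall i, Dge (fs i) (es i) d.
Proof.
split=> [Qd i|fd r' c' gs es' c'0 gI e'0 gN eQ' k].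
  by apply: (Qd r c) => // k; exact: prime_mirreducible.
have gP := mirreducible_prime (gI k).
have gQ : rdvd (gs k ^+ es' k) Q.
  by rewrite eQ' (bigD1 k) //=; apply: rdvd_mulr; apply: rdvd_mull; exact: rdvd_refl.
have [i fig] : exists i, rdvd (gs k) (fs i).
  have : rdvd (gs k) Q.
    apply: rdvd_trans gQ; rewrite -[X in rdvd X _]expr1; exact: rdvd_exp_le.
  rewrite eQ => /(prime_rdvd_unitl (mpolyC_unit c0)) /(prime_rdvd_prod gP)[i _].
  by move/(prime_rdvd_exp gP); exists i.
have gf := prime_massociated gP (fP i) fig.
apply: Dge_assoc gf _; apply: (Dge_le (e := es i)) (fd i).
apply: (prime_exp_le (fP i) (@factor_compl_ndvdC i)); rewrite -factorization_compl.
by apply: rdvd_trans gQ; apply: rdvd_exp; exact: prime_rdvd_sym gP (fP i) fig.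
Qed.

End Factorization.

Lemma exists_factorization Q : Q != 0 -> exists r (c : K) (fs : 'I_r -> S) (es : 'I_r -> nat),
  [/\ c != 0, forall i, prime_elt (fs i), forall i, (0 < es i)%N,
    forall i j, i != j -> ~ massociated (fs i) (fs j) &
    Q = c%:MP * \prod_(i < r) fs i ^+ es i].
Proof.
move=> /factorial_mpoly[w [ps [wU /group_primes[r [w' [fs [es [w'U fP e0 fN epr]]]]] eQ]]].
have [c c0 ew] : exists2 c, c != 0 & w * w' = c%:MP.
  by apply: mpoly_unitP; rewrite unitrM wU.
by exists r, c, fs, es; split=> //; rewrite eQ epr mulrA ew.
Qed.

(* A partial derivative has smaller degree, and in characteristic zero not all
   of them vanish. *)
Lemma exists_deriv_ndvd (charK0 : [pchar K] =i pred0) f : prime_elt f ->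
  exists l, ~ rdvd f f^`M(l).
Proof.
move=> [f0 fU _]; apply: contrapT => nex.
have all0 l : f^`M(l) = 0.
  apply/eqP/negPn/negP => d0.
  have [c ec] : rdvd f f^`M(l) by apply: contrapT => nd; apply: nex; exists l.
  have c0 : c != 0 by apply: contraNneq d0 => z; rewrite ec z mul0r.
  have : (msize f^`M(l) < msize f)%N.
    rewrite -mlead_deg //; have := mlead_supp d0; rewrite mcoeff_msupp mcoeff_deriv => ne.
    have : (mlead f^`M(l) + U_(l))%MM \in msupp f.
      by rewrite mcoeff_msupp; apply: contraNneq ne => ->; rewrite mul0rn.
    by move/msize_mdeg_lt; rewrite mdegD mdeg1 addn1.
  rewrite ec msizeM // => lt; have : (0 < msize c)%N by rewrite lt0n msize_poly_eq0.
  by move: (msize c) (msize f) lt; clear; lia.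
have ef : f = (f@_0%MM)%:MP.
  apply/mpolyP => m; rewrite mcoeffC; case: eqP => [->|/eqP m0]; first by rewrite mulr1.
  rewrite mulr0; have [l ml] : exists l, m l != 0%N.
    apply: contrapT => nl; case/eqP: m0; apply/mnmP => l; rewrite mnm0E.
    by apply/eqP/negPn/negP => ml; apply: nl; exists l.
  have /submK em : (U_(l) <= m)%MM by rewrite lep1mP.
  have := congr1 (mcoeff (m - U_(l))%MM) (all0 l).
  rewrite mcoeff_deriv em mcoeff0 => /eqP; rewrite -mulr_natl mulf_eq0.
  by rewrite ((pcharf0P K).1 charK0) => /eqP.
case/negP: fU; rewrite ef; apply: rmorph_unit; rewrite unitfE.
by apply: contraNneq f0 => z; rewrite ef z mpolyC0.
Qed.

End Derivations.

(** * The two bounds and the value of chi *)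

Section LogarithmicModule.
Variables (K : fieldType) (n : nat) (u v : 'I_n -> int) (k : int).
Variables (Q : {mpoly K[n]}) (dQ : int).
Hypotheses (u0 : forall i, 0 < u i) (uv : forall i, u i + v i = k).
Hypotheses (Q0 : Q != 0) (hQ : whomog u dQ Q).
Variables (r : nat) (c : K) (fs : 'I_r -> {mpoly K[n]}) (es : 'I_r -> nat).
Variable (d : 'I_r -> int).
Hypotheses (c0 : c != 0) (fP : forall i, prime_elt (fs i)) (e0 : forall i, (0 < es i)%N).
Hypothesis fN : forall i j, i != j -> ~ massociated (fs i) (fs j).
Hypothesis eQ : Q = c%:MP * \prod_(i < r) fs i ^+ es i.
Hypothesis hd : forall i, whomog u (d i) (fs i).
Local Notation DerV := {ffun 'I_n -> {mpoly K[n]}}.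

Let D i : int := (es i)%:Z * d i.
Let P j (x : DerV) := Dpiece u v Q j x.
Let DP := DlogP c0 fP e0 fN eQ.

Let fes0 i : fs i ^+ es i != 0.
Proof. by case: (fP i) => f0 _ _; rewrite expf_neq0. Qed.

Let hD : forall i, whomog u (D i) (fs i ^+ es i).
Proof. by move=> i; exact: whomog_exp. Qed.

Lemma sum_factor_degrees : \sum_i D i = dQ.
Proof.
apply: (whomog_uniq Q0) hQ; rewrite eQ -[\sum_i _]add0r.
by apply: whomogM; [exact: whomogC|exact: whomog_prod].
Qed.

Lemma whomog_compl i : whomog u (dQ - D i) (factor_compl fs es i).
Proof.
have h1 : whomog u (dQ - D i) (c%:MP * factor_compl fs es i).
  by apply: (whomog_quot u0 (fes0 i) (@hD i)); rewrite -(factorization_compl eQ i).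
have := whomog_quot u0 _ (@whomogC K n u c) h1; rewrite subr0; apply.
by rewrite mpolyC_eq0.
Qed.

Lemma der_apply_lin (a : K) (x y : DerV) g :
  der_apply (a *: x + y) g = a *: der_apply x g + der_apply y g.
Proof.
rewrite /der_apply scaler_sumr -big_split; apply: eq_bigr => i _.
by rewrite !ffunE mulrDl scalerAl.
Qed.

Lemma subspace_Dpiece j : subspace (P j).
Proof.
have [p0 plin] := subspace_piece K u v j.
split=> [|a x y [Qx px] [Qy py]]; (split; last by [exact: p0|exact: plin]); apply/DP => i.
  by exists 0; rewrite mul0r; apply: big1 => m _; rewrite ffunE mul0r.
have [s es'] := (DP _).1 Qx i; have [t et] := (DP _).1 Qy i.
by exists (a *: s + t); rewrite der_apply_lin es' et mulrDl scalerAl.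
Qed.

Lemma Dpiece_mulX m j x : P j x -> P (j + wdeg u m) [ffun i => x i * 'X_[m]].
Proof.
move=> [Qx px]; split; last first.
  move=> i; rewrite ffunE; have -> : j + wdeg u m - v i = j - v i + wdeg u m by ring.
  by apply: whomogM; [exact: px|exact: whomogX].
apply/DP => i; have [s es'] := (DP _).1 Qx i; exists (s * 'X_[m]).
rewrite mulrAC -es' /der_apply mulr_suml; apply: eq_bigr => t _.
by rewrite ffunE mulrAC.
Qed.

Let L := lead_set u v P.

Definition log_dim j := (\sum_(i < n) count (L i) (mons (weights u) (j - v i)))%N.

Lemma log_dimE j : (log_dim j)%:Z = hfun u v L j.
Proof. by rewrite -natz natr_sum; apply: eq_bigr => i _; rewrite natz. Qed.

Lemma hasdim_Dpiece j : hasdim (P j) (log_dim j).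
Proof. by apply: (hasdim_lead_set u0 (subspace_Dpiece j)) => x []. Qed.

(** Passes from finite functions, which form a module, to plain coefficient functions compared
    pointwise. *)
Lemma has_dim_Dpiece j : has_dim (Dpiece u v Q j) (log_dim j).
Proof.
have [b [Pb fb sb]] := hasdim_Dpiece j.
exists (fun k i => b k i); split=> [m|a ae|x [Qx px]].
- exact: Pb.
- apply: fb; apply/ffunP => i; rewrite /comb sum_ffunE ffunE -[RHS](ae i).
  by apply: eq_bigr => m _; rewrite ffunE.
- have [|a ea] := sb [ffun i => x i].
    split; last by move=> i; rewrite ffunE; exact: px.
    apply/DP => i; have [s es'] := (DP _).1 Qx i; exists s; rewrite -es'.
    by apply: eq_bigr => m _; rewrite ffunE.
  exists a => i; have /ffunP/(_ i) := ea; rewrite ffunE => ->.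
  by rewrite /comb sum_ffunE; apply: eq_bigr => m _; rewrite ffunE.
Qed.

Lemma good_log_dim : good (weights u) (hfun u v L).
Proof. by apply: (good_hfun u0) => i; apply: upset_lead_set => m j x; exact: Dpiece_mulX. Qed.

(** The shift that makes evaluation at [fs i] homogeneous of degree 0. *)
Let w i := k - d i.

(** In degree [j], D / D(Q) is no larger than the sum of the S / f_i^{e_i} shifted by [w], because
    D(Q) is the preimage of the tuples divisible by the f_i^{e_i} under evaluation at the f_i. *)
Lemma log_codim_le j :
  0 <= hfree u w j + hfun u v L j - hfree u v j - hfree u (fun i => w i + D i) j.
Proof.
have [p hp ep] := @hasdim_piece K n u u0 n v j.
have [p1 hp1 ep1] := @hasdim_piece K n u u0 r w j.
have [p2 hp2 ep2] := hasdim_divisible_piece u0 w j fes0 (@hD).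
pose phi (x : DerV) := [ffun i => der_apply x (fs i)].
have phiw x : piece u v j x -> piece u w j (phi x).
  move=> px i; rewrite ffunE; apply: whomog_sum => m _.
  have -> : j - w i = j - v m + (d i - u m) by rewrite /w -(uv m); ring.
  by apply: whomogM; [exact: px|exact: whomog_deriv].
suff : (p + p2 <= p1 + log_dim j)%N.
  by rewrite -ep -ep1 -ep2 -log_dimE; clear; lia.
apply: (@codim_le K _ _ phi (piece u v j) (P j) (piece u w j)
  (fun x => piece u w j x /\ forall i, mdvd (fs i ^+ es i) (x i))) => //;
  try exact: subspace_piece.
- by move=> a x y; apply/ffunP => i; rewrite !ffunE der_apply_lin.
- move=> x; split=> [[Qx px]|[px [_ dx]]].
    split=> //; split; first exact: phiw.
    by move=> i; rewrite ffunE; exact: (DP _).1.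
  by split=> //; apply/DP => i; have := dx i; rewrite ffunE.
- by move=> x [].
- exact: hasdim_Dpiece.
- have [q0 qlin] := subspace_piece K u w j.
  split=> [|a x y [px dx] [py dy]]; split; [exact: q0| |exact: qlin|] => i.
    by rewrite ffunE; exact: rdvd0.
  rewrite !ffunE; apply: rdvdD; last exact: dy.
  by rewrite -mul_mpolyC; apply: rdvd_mulr; exact: dx.
Qed.

Variable l : 'I_r -> 'I_n.
Hypothesis hl : forall i, ~ rdvd (fs i) (fs i)^`M(l i).

(** The degree of g_i theta_i: [v (l i)] from the partial derivative and [dQ - D i] from g_i. *)
Let z i := v (l i) + (dQ - D i).

(** In degree [j], the sum of the S / f_i^{e_i} shifted by [z] is no larger than D / D(Q), because
    the preimage of D(Q) under [phi] consists exactly of the tuples with [x i] divisible by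
    f_i^{e_i}. *)
Lemma log_codim_ge j :
  0 <= hfree u v j + hfree u (fun i => z i + D i) j - hfree u z j - hfun u v L j.
Proof.
have [p hp ep] := @hasdim_piece K n u u0 n v j.
have [p1 hp1 ep1] := @hasdim_piece K n u u0 r z j.
have [p2 hp2 ep2] := hasdim_divisible_piece u0 z j fes0 (@hD).
pose phi (x : {ffun 'I_r -> {mpoly K[n]}}) : DerV :=
  [ffun m => \sum_(i | l i == m) x i * factor_compl fs es i].
have phiE x g : der_apply (phi x) g = \sum_i x i * factor_compl fs es i * g^`M(l i).
  rewrite /der_apply (partition_big l xpredT) //=; apply: eq_bigr => m _.
  by rewrite ffunE mulr_suml; apply: eq_bigr => i /eqP ->.
have phiw x : piece u z j x -> piece u v j (phi x).
  move=> px m; rewrite ffunE; apply: whomog_sum => i /eqP <-.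
  have -> : j - v (l i) = j - z i + (dQ - D i) by rewrite /z; ring.
  by apply: whomogM; [exact: px|exact: whomog_compl].
have phid x : (forall i, Dge (fs i) (es i) (phi x)) <->
    forall i, mdvd (fs i ^+ es i) (x i).
  have rest i : rdvd (fs i ^+ es i)
      (\sum_(i' | i' != i) x i' * factor_compl fs es i' * (fs i)^`M(l i')).
    apply: rdvd_sum => i' ni; apply: rdvd_mull; apply: rdvd_mulr.
    rewrite /factor_compl (bigD1 i) /=; last by rewrite eq_sym.
    by apply: rdvd_mull; exact: rdvd_refl.
  split=> H i; have := H i; rewrite /Dge phiE (bigD1 i) //=.
    rewrite addrC => /(rdvd_addr (rest i)); rewrite -mulrA.
    apply: prime_exp_cancel => //; have [_ _ primef] := fP i.
    by case/primef => [|/hl//]; exact: factor_compl_ndvd.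
  move=> xd; apply: rdvdD; last exact: rest.
  by apply: rdvd_mull; exact: rdvd_mull.
suff : (p1 + log_dim j <= p + p2)%N.
  by rewrite -ep -ep1 -ep2 -log_dimE; clear; lia.
apply: (@codim_le K _ _ phi (piece u z j)
  (fun x => piece u z j x /\ forall i, mdvd (fs i ^+ es i) (x i))
  (piece u v j) (P j)) => //; try exact: subspace_piece.
- move=> a x y; apply/ffunP => m; rewrite !ffunE scaler_sumr -big_split /=.
  by apply: eq_bigr => i _; rewrite !ffunE mulrDl scalerAl.
- move=> x; split=> [[px dx]|[px [/DP /phid dx _]]]; last by [].
  by split=> //; split; [apply/DP/phid|exact: phiw].
- by move=> x [].
- exact: hasdim_Dpiece.
- exact: subspace_Dpiece.
Qed.

Lemma chi_log_dim : chi_is u log_dim (dQ + \sum_(i < n) v i).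
Proof.
have wgt0 := weights_gt0 u0.
have [rho [chi lau]] := (goodP _ _).1 good_log_dim.
(* A common bound for all shifts: every Hilbert function involved vanishes below [-a]. *)
pose a := (\sum_i absz (v i) + \sum_i absz (w i)%R + \sum_i absz (w i + D i)%R
  + \sum_i absz (z i)%R + \sum_i absz (z i + D i)%R)%N.
have [] := laurent_pos (a := a) wgt0 log_codim_le _ (laurent_ext _ (laurentB (laurentB
  (laurentD (laurent_hfree u0 w) lau) (laurent_hfree u0 v))
  (laurent_hfree u0 (fun i => w i + D i)))).
- by move=> j ja; rewrite /hfree !(hfun_lt u0 _ _ ja) /a; try (clear; lia).
- by move=> j; rewrite !deltasB deltasD.
have [] := laurent_pos (a := a) wgt0 log_codim_ge _ (laurent_ext _ (laurentB (laurentB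
  (laurentD (laurent_hfree u0 v) (laurent_hfree u0 (fun i => z i + D i)))
  (laurent_hfree u0 z)) lau)).
- by move=> j ja; rewrite /hfree !(hfun_lt u0 _ _ ja) /a; try (clear; lia).
- by move=> j; rewrite !deltasB deltasD.
have sumwD (y : 'I_r -> int) : \sum_i (y i + D i) = \sum_i y i + dQ.
  by rewrite big_split sum_factor_degrees.
rewrite !sumwD.
move: (\sum_i z i) (\sum_i w i) (\sum_i v i) => sz sw sv r1 x1 r2 x2.
(* The values at 1 of the two differences are [rho - n] and [n - rho], both nonnegative. The
   derivatives, [chi - sv - dQ] and its opposite, are then both at most 0. *)
have erho : rho = n%:Z by lia.
have echi : chi = dQ + sv.
  have /x1 y1 : n%:Z + r%:Z - r%:Z - rho = 0 by rewrite erho; lia.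
  have /x2 y2 : r%:Z + rho - n%:Z - r%:Z = 0 by rewrite erho; lia.
  by lia.
rewrite -echi; case: lau => N [supN s1 s2]; exists N.
have hc j : hcoef u log_dim j = deltas (weights u) (hfun u v L) j.
  by rewrite hcoef_deltas //; apply: deltas_ext; exact: log_dimE.
split=> [j /supN <-//|]; rewrite -s2; apply: eq_bigr => m _.
by rewrite hc.
Qed.

End LogarithmicModule.

Theorem mainTheorem11 (K : fieldType) (charK0 : [pchar K] =i pred0)
    (n : nat) (u v : 'I_n -> int) (k : int) (Q : {mpoly K[n]}) (dQ : int) :
  (forall i, 0 < u i) ->
  (forall i, u i + v i = k) ->
  Q != 0 ->
  whomog u dQ Q ->
  exists h : int -> nat,
    (forall j : int, has_dim (Dpiece u v Q j) (h j)) /\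
    chi_is u h (dQ + \sum_(i < n) v i).
Proof.
move=> u0 uv Q0 hQ.
have [r [c [fs [es [c0 fP e0 fN eQ]]]]] := exists_factorization Q0.
have /choice[d hd] : forall i, exists e, whomog u e (fs i).
  move=> i; have := Q0; have := hQ.
  (* As [es i] is positive, one copy of [fs i] splits off and [Q] is [fs i] times a cofactor. *)
  rewrite (factorization_compl eQ i) -(prednK (e0 i)) exprS -mulrA => h1 h2.
  exact: (whomog_factor u0 h2 h1).
have /choice[l hl] : forall i, exists m, ~ rdvd (fs i) (fs i)^`M(m).
  by move=> i; exact: exists_deriv_ndvd.
exists (log_dim u v Q); split=> [j|].
  exact: (has_dim_Dpiece v u0 c0 fP e0 fN eQ).
exact: (chi_log_dim u0 uv Q0 hQ c0 fP e0 fN eQ hd hl).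
Qed.
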